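(* Let $m\ge4$. Every variety $\mathbf{V}$ of involution semigroups satisfying $\operatorname{var}\mathcal{K}_3^\rho\subseteq\mathbf{V}\subseteq\operatorname{var}\mathcal{W}_{m+1}^\rho$, or satisfying $\operatorname{var}\mathcal{K}_4^\rho\subseteq\mathbf{V}\subseteq\operatorname{var}\mathcal{W}_m^\rho$, is nonfinitely based.
   Context: For $n\ge2$, let $[n]=\{1,\dots,n\}$ and $[n]'=\{1',\dots,n'\}$. The wire monoid $\mathcal{W}_n$ has as elements all pairs $(\pi;d)$ where $\pi$ is a partition of $[n]\cup[n]'$ into 2-element blocks and $d\ge0$ is an integer. The product of $\xi=(\pi_1;d_1)$ and $\eta=(\pi_2;d_2)$ is defined as follows. Take a third disjoint copy $[n]''$ and form the multigraph $\Gamma$ on $[n]\cup[n]''\cup[n]'$ with edges: $\{\sigma(x),\sigma(y)\}$ for blocks $\{x,y\}$ of $\pi_1$, where $\sigma$ fixes $[n]$ and sends $k'\mapsto k''$; and $\{\tau(x),\tau(y)\}$ for blocks of $\pi_2$, where $\tau$ sends $k\mapsto k''$ and fixes $[n]'$. Then $\xi\eta=(\pi;d_1+d_2+m)$, where the blocks of $\pi$ are the endpoint pairs of the path components of $\Gamma$ and $m$ is the number of cycle components. The reflection is $(\pi;d)^*=(\pi^*;d)$, obtained by swapping $k\leftrightarrow k'$ in all blocks. The rotation is $\xi^\rho=\alpha\xi^*\alpha$, where $\alpha=(\{\{k,(n+1-k)'\}\mid k\in[n]\};0)$; it is an involution (involutory anti-automorphism). The hooks are $h_i=(\{\{i,i+1\},\{i',(i+1)'\}\}\cup\{\{j,j'\}\mid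 j\ne i,i+1\};0)$ and the circle is $c=(\{\{j,j'\}\mid j\in[n]\};1)$. The Kauffman monoid $\mathcal{K}_n$ is the submonoid of $\mathcal{W}_n$ generated by $c,h_1,\dots,h_{n-1}$; the rotation fixes $c$ and maps $h_i\mapsto h_{n-i}$. $\mathcal{W}_n^\rho$ and $\mathcal{K}_n^\rho$ denote $\mathcal{W}_n$ and $\mathcal{K}_n$ regarded as involution semigroups under the rotation. $\operatorname{var}$ denotes the generated variety of involution semigroups. A variety is nonfinitely based if it has no finite basis of identities. *)

(* Defs.v *)
From HB Require Import structures.
From Stdlib Require Import ClassicalEpsilon.
From Stdlib Require List.
From mathcomp Require Import all_boot.
Set Implicit Arguments. Unset Strict Implicit. Unset Printing Implicit Defensive.

Record istruct := IStruct {
  icar : Type;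
  iop : icar -> icar -> icar;
  istar : icar -> icar }.

Definition is_invsg (S : istruct) : Prop :=
  (forall x y z : icar S, @iop S (@iop S x y) z = @iop S x (@iop S y z)) /\
  (forall x : icar S, @istar S (@istar S x) = x) /\
  (forall x y : icar S, @istar S (@iop S x y) = @iop S (@istar S y) (@istar S x)).

Inductive term := tvar of nat | tmul of term & term | tstar of term.

Fixpoint eval (S : istruct) (v : nat -> icar S) (t : term) : icar S :=
  match t with
  | tvar k => v k
  | tmul t1 t2 => @iop S (eval v t1) (eval v t2)
  | tstar t1 => @istar S (eval v t1)
  end.

Definition identity := (term * term)%type.

Definition sat (S : istruct) (e : identity) : Prop :=
  forall v : nat -> icar S, eval v e.1 = eval v e.2.

Definition Mod (Sigma : identity -> Prop) (S : istruct) : Prop :=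
  is_invsg S /\ forall e, Sigma e -> sat S e.

(* A variety of involution semigroups: an equationally defined class
   (equivalently, by Birkhoff, a class closed under H, S, P). *)
Definition is_variety (V : istruct -> Prop) : Prop :=
  exists Sigma : identity -> Prop, forall S, V S <-> Mod Sigma S.

Definition var (S0 : istruct) : istruct -> Prop := Mod (sat S0).

Definition subclass (V W : istruct -> Prop) : Prop := forall S, V S -> W S.

Definition finitely_based (V : istruct -> Prop) : Prop :=
  exists l : list identity, forall S, V S <-> Mod (fun e => List.In e l) S.

(* Points of [n] ∪ [n]': inl k is the point k+1, inr k is (k+1)'. *)
Definition pt (n : nat) := ('I_n + 'I_n)%type.

Definition swap_pt n (x : pt n) : pt n :=
  match x with inl k => inr k | inr k => inl k end.

(* A partition into 2-element blocks = fixed-point-free involution. *)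
Definition is_matching n (f : {ffun pt n -> pt n}) : bool :=
  [forall x, (f (f x) == x) && (f x != x)].

Definition matching n := {f : {ffun pt n -> pt n} | is_matching f}.

Definition idraw n : {ffun pt n -> pt n} := [ffun x => swap_pt x].

Lemma idraw_matching n : is_matching (idraw n).
Proof. by apply/forallP => -[k|k]; rewrite !ffunE /= eqxx. Qed.

Definition idm n : matching n := exist _ (idraw n) (idraw_matching n).

(* The matching whose partner function is "the y with r x y"
   (d is a fallback, never used when r describes a matching). *)
Definition mk_matching n (d : matching n) (r : pt n -> pt n -> bool) : matching n :=
  insubd d [ffun x => odflt x [pick y | r x y]].

Definition wire n := (matching n * nat)%type.

(* Vertices of Γ: inl k = k (in [n]), inr (inl k) = k'' , inr (inr k) = k'. *)
Definition gv n := ('I_n + ('I_n + 'I_n))%type.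

Definition sigma_v n (x : pt n) : gv n :=
  match x with inl k => inl k | inr k => inr (inl k) end.
Definition tau_v n (x : pt n) : gv n :=
  match x with inl k => inr (inl k) | inr k => inr (inr k) end.
Definition omega_v n (x : pt n) : gv n :=
  match x with inl k => inl k | inr k => inr (inr k) end.

(* (underlying simple graph of the) multigraph Γ *)
Definition gedge n (f1 f2 : matching n) : rel (gv n) := fun a b =>
  [exists x : pt n, (sigma_v x == a) && (sigma_v (val f1 x) == b)] ||
  [exists x : pt n, (tau_v x == a) && (tau_v (val f2 x) == b)].

(* vertices not connected to any outer vertex (i.e. on cycle components) *)
Definition cyc_vert n (f1 f2 : matching n) : {set gv n} :=
  [set a | [forall x : pt n, ~~ connect (gedge f1 f2) (omega_v x) a]].

Definition ncycles n (f1 f2 : matching n) : nat :=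
  #|[set [set b | connect (gedge f1 f2) a b] | a in cyc_vert f1 f2]|.

(* endpoint pairs of the path components *)
Definition prod_match n (f1 f2 : matching n) : matching n :=
  mk_matching f1 (fun x y => (y != x) && connect (gedge f1 f2) (omega_v x) (omega_v y)).

Definition wmul n (a b : wire n) : wire n :=
  (prod_match a.1 b.1, a.2 + b.2 + ncycles a.1 b.1).

Definition wrefl n (a : wire n) : wire n :=
  (insubd a.1 [ffun x => swap_pt (val a.1 (swap_pt x))], a.2).

Definition alpha n : wire n :=
  (mk_matching (idm n) (fun x y => match x, y with
     | inl k, inr l => val l == n.-1 - k
     | inr k, inl l => val l == n.-1 - k
     | _, _ => false end), 0).

Definition wrot n (a : wire n) : wire n := wmul (wmul (alpha n) (wrefl a)) (alpha n).

Definition hook n (i : nat) : wire n :=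
  (mk_matching (idm n) (fun x y => match x, y with
     | inl k, inl l | inr k, inr l =>
         ((k.+1 == i) && (val l == i)) || ((val k == i) && (l.+1 == i))
     | inl k, inr l | inr k, inl l =>
         [&& val k == val l, k.+1 != i & val k != i] end), 0).

Definition circle n : wire n := (idm n, 1).
Definition wone n : wire n := (idm n, 0).

Definition Wrho n : istruct := @IStruct (wire n) (@wmul n) (@wrot n).

Inductive inK n : wire n -> Prop :=
  | K1 : inK (wone n)
  | Kc : inK (circle n)
  | Kh i : 0 < i < n -> inK (hook n i)
  | Km a b : inK a -> inK b -> inK (wmul a b).

Definition kel n := {a : wire n | inK a}.

Definition kmul n (a b : kel n) : kel n :=
  exist _ (wmul (proj1_sig a) (proj1_sig b)) (Km (proj2_sig a) (proj2_sig b)).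

(* restriction of the rotation (K_n is closed under it; fallback unused) *)
Definition krot n (a : kel n) : kel n :=
  match excluded_middle_informative (inK (wrot (proj1_sig a))) with
  | left p => exist _ _ p
  | right _ => a
  end.

Definition Krho n : istruct := @IStruct (kel n) (@kmul n) (@krot n).

(* Main.v *)
Require Import Defs.
From mathcomp Require Import all_boot.
From mathcomp Require Import zify.
From Stdlib Require Import ClassicalEpsilon.
Set Implicit Arguments. Unset Strict Implicit. Unset Printing Implicit Defensive.

(** K_3 and K_4 under rotation contain an involution submonoid made of the powers of the circle and of a
    2 x 2 Rees matrix semigroup over them. Its identities are rigid: deleting letters and counting circles
    detects which pairs of letters are adjacent in a word. Fix a bound n on the sizes of the identities of
    a putative finite basis, and let w be the fixed point of a block substitution with more than 4n columns.
    If u = v holds in the Rees monoid, u has at most n letters and a substitution sends u to a factor of w,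
    then some two adjacent columns are never separated by the ends of the images of letters; these two columns
    carry the desubstituted word, so by induction on the length u and v have the same image.
    Hence the involution semigroup of factors of w, their formal stars and zero satisfies the basis.
    On the other hand W_m satisfies x t y = y t x whenever the words x and y have the same values in the
    finite monoid of matchings. By pigeonhole such x, t, y of suitable lengths occur consecutively in w,
    and x t y = y t x as words would produce a square in w, which is square-free. *)

(** * The square-free word *)

(* zword r is the fixed point of the substitution sending the letter (p, q), with column p and row q, to the
   block of the letters (j, q) for even j and (j, p) for odd j, j < r; k is fuel, sufficient when k >= t. *)
Fixpoint zrow (r k t : nat) : nat :=
  if k is k'.+1 then
    if odd (t %% r) then (t %/ r) %% r else zrow r k' (t %/ r)
  else 0.

Definition zword (r t : nat) : nat * nat := (t %% r, zrow r t t).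

Lemma zrow0 r k : zrow r k 0 = 0.
Proof. by elim: k => //= k IH; rewrite mod0n div0n. Qed.

Lemma zrow_fuel r k t : 1 < r -> t <= k -> zrow r k t = zrow r t t.
Proof.
move=> r_gt1; elim/ltn_ind: k t => -[|k] IH [|t] // tk; first by rewrite !zrow0.
have lt_t : t.+1 %/ r <= t by rewrite -ltnS ltn_Pdiv.
rewrite /=; case: ifP => // _.
by rewrite (IH k) ?(IH t) // (leq_trans lt_t).
Qed.

Lemma zword_block r s j : 1 < r -> j < r ->
  zword r (s * r + j) = (j, if odd j then (zword r s).1 else (zword r s).2).
Proof.
move=> r_gt1 lt_jr; have r_gt0 : 0 < r by lia.
have modE : (s * r + j) %% r = j by rewrite modnMDl modn_small.
have divE : (s * r + j) %/ r = s by rewrite divnMDl // divn_small ?addn0.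
rewrite /zword modE; congr (_, _).
rewrite -(@zrow_fuel r (s * r + j).+1) //= modE divE.
case: ifP => // _; apply: zrow_fuel => //; nia.
Qed.

Lemma zword_bound r t : 1 < r -> ((zword r t).1 < r) && ((zword r t).2 < r).
Proof.
move=> r_gt1; have r_gt0 : 0 < r by lia.
rewrite /= ltn_pmod //=; elim: {1}t {2}t => //= k IH {}t.
by case: ifP => _; rewrite ?ltn_pmod.
Qed.

(** Descent on the period. The columns force [r] to divide [p], and two neighbouring columns of a
    block recover both coordinates of the letter that it replaces, which yields a square of period
    [p / r]. *)
Lemma zword_square_free r x p : 3 < r -> 0 < p ->
  ~ (forall d, d < p -> zword r (x + d) = zword r (x + d + p)).
Proof.
move=> r_gt3; have r_gt1 : 1 < r by lia.
elim/ltn_ind: p x => p IH x p_gt0 sq.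
have [q def_p] : exists q, p = q * r.
  have [/esym/eqP] := sq 0 p_gt0.
  rewrite addn0 -{2}[x]addn0 eqn_modDl mod0n => /dvdnP[q ->]; by exists q.
have q_gt0 : 0 < q by case: q def_p p_gt0 => // ->.
(* As [r > 3], any [r] consecutive positions contain the columns [j] and [j.+1] of a single block
   with [j] even. *)
have [j [a [evenj jr xa ap]]] : exists j a,
    [/\ ~~ odd j, j.+1 < r, x <= a * r + j & a * r + j.+1 < x + r].
  have xE := divn_eq x r; have xr : x %% r < r by rewrite ltn_pmod; lia.
  move: (x %/ r) (x %% r) xE xr => b [|[|c]] -> xr.
  - by exists 0, b; split; lia.
  - by exists 2, b; split=> //; lia.
  - by exists 0, b.+1; split => //; nia.
apply: (IH q _ a) => // [|d lt_dq]; first by nia.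
have row i : i < r -> x <= a * r + i -> a * r + i < x + r ->
    zword r ((a + d) * r + i) = zword r ((a + d + q) * r + i).
  move=> ir le1 lt2.
  have -> : (a + d) * r + i = x + ((a + d) * r + i - x) by nia.
  rewrite sq; last by rewrite def_p; nia.
  by congr zword; rewrite def_p; nia.
have := row j (ltnW jr) xa ltac:(lia); have := row j.+1 jr ltac:(lia) ap.
rewrite !zword_block ?(ltnW jr) //= (negbTE evenj) /= => -[e1] [e2].
by rewrite /zword e1 e2.
Qed.

(** * Factors of the word *)

Definition rows (j : nat) (s : seq (nat * nat)) : seq nat :=
  [seq c.2 | c <- s & c.1 == j].

Definition zfactor (r t L : nat) : seq (nat * nat) := [seq zword r i | i <- iota t L].

Lemma zfactorD r t L1 L2 : zfactor r t (L1 + L2) = zfactor r t L1 ++ zfactor r (t + L1) L2.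
Proof. by rewrite /zfactor iotaD map_cat. Qed.

(** The number of positions below [t] that lie in column [h]. *)
Definition column_count (r h t : nat) : nat := t %/ r + (h < t %% r).

(** Column [h] meets each block once and shows there a fixed coordinate of the letter replaced by
    the block, so its rows follow consecutive letters of the word. *)
Lemma rows_zfactor r h t L : 1 < r -> h < r ->
  rows h (zfactor r t L) =
  [seq (if odd h then (zword r s).1 else (zword r s).2)
     | s <- iota (column_count r h t) (column_count r h (t + L) - column_count r h t)].
Proof.
move=> r_gt1 hr; elim: L => [|L IH]; first by rewrite addn0 subnn.
have le_count : column_count r h t <= column_count r h (t + L).
  rewrite /column_count; have := divn_eq t r; have := divn_eq (t + L) r.
  have : t %% r < r by rewrite ltn_pmod; lia.
  have : (t + L) %% r < r by rewrite ltn_pmod; lia.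
  move: (t %/ r) (t %% r) ((t + L) %/ r) ((t + L) %% r) => a b c d dr br e1 e2.
  have [ac|ac|ac] := ltngtP a c; first by lia.
    by have : c.+1 * r <= a * r; [rewrite leq_mul2r ac orbT|rewrite mulSn; lia].
  rewrite -ac in e1 *; have bd : b <= d by lia.
  by rewrite leq_add2l; case: ltnP => // hb; rewrite (leq_trans hb bd).
rewrite -addn1 zfactorD /rows filter_cat map_cat -/(rows _ _) IH addnA /=.
move: le_count; rewrite {}/IH; have := divn_eq (t + L) r.
have : (t + L) %% r < r by rewrite ltn_pmod; lia.
move: (column_count r h t) => k; rewrite /column_count.
move: (t + L) => y; move: (y %/ r) (y %% r) => a b br -> le_k.
have -> : (a * r + b + 1) %/ r = a + (b.+1 == r).
  case: eqP => [e|ne]; first by rewrite -addnA addn1 e divnMDl ?divnn; lia.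
  by rewrite -addnA divnMDl ?divn_small; lia.
have -> : (a * r + b + 1) %% r = if b.+1 == r then 0 else b.+1.
  case: eqP => [e|ne]; first by rewrite -addnA addn1 e -mulSnr modnMl.
  by rewrite -addnA modnMDl modn_small; lia.
rewrite [zword r _]zword_block //=; case: eqP => [eb|neb].
  subst h; rewrite ltnn addn0 in le_k.
  have -> : a + (b.+1 == r) + (b < (if b.+1 == r then 0 else b.+1)) - k
            = (a + (b < b) - k) + 1 by rewrite ltnn; case: eqP => ?; rewrite ?ltnSn /=; lia.
  rewrite iotaD map_cat /= ltnn addn0; congr (_ ++ [:: _]).
  by have -> : k + (a - k) = a by lia.
rewrite cats0; congr [seq _ | _ <- iota _ _].
by case: eqP => ?; lia.
Qed.

Lemma size_rows_zfactor r h t L : 1 < r -> h < r -> 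
  size (rows h (zfactor r t L)) = column_count r h (t + L) - column_count r h t.
Proof. by move=> r1 hr; rewrite rows_zfactor // size_map size_iota. Qed.

(** The counts differ only when the boundary [t] falls between columns [h] and [h.+1] of one
    block. *)
Lemma column_count_uncut r h t : t %% r != h.+1 ->
  column_count r h t = column_count r h.+1 t.
Proof. by rewrite /column_count => ?; lia. Qed.

(* Two adjacent columns of opposite parity carry both coordinates of the letter substituted by their block. *)
Definition unblock (g : nat) (s : seq (nat * nat)) : seq (nat * nat) :=
  zip (rows g.*2.+1 s) (rows g.*2 s).

(** Neither end separates a letter of column [g.*2] from its right neighbour in column [g.*2.+1];
    through [ohead] the empty word is uncut. *)
Definition uncut (g : nat) (s : seq (nat * nat)) : Prop :=
  forall c, (ohead s = Some c -> c.1 != g.*2.+1) /\ (ohead (rev s) = Some c -> c.1 != g.*2).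

Lemma zfactor_uncut r g t L : 1 < r -> g.*2.+1 < r -> uncut g (zfactor r t L) -> 0 < L ->
  (t %% r != g.*2.+1) && ((t + L) %% r != g.*2.+1).
Proof.
move=> r1 gr H; case: L H => // L H _.
have [/(_ erefl) /= -> _] := H (zword r t).
have [_] := H (zword r (t + L)).
rewrite -addn1 zfactorD rev_cat /= => /(_ erefl) /=.
apply: contra; rewrite addnA => /eqP e; apply/eqP.
have := divn_eq (t + L) r; have : (t + L) %% r < r by rewrite ltn_pmod; lia.
move: ((t + L) %/ r) ((t + L) %% r) e => a b + br E; rewrite E => e.
have [eb|nb] := eqVneq b.+1 r.
  by move: e; rewrite -addnA addn1 eb -mulSnr modnMl.
by move: e; rewrite -addnA addn1 modnMDl modn_small; lia.
Qed.

Lemma size_rows_uncut r g t L : 1 < r -> g.*2.+1 < r -> uncut g (zfactor r t L) ->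
  size (rows g.*2.+1 (zfactor r t L)) = size (rows g.*2 (zfactor r t L)).
Proof.
move=> r1 gr H; have gr' : g.*2 < r by lia.
case: L H => // L H.
have /andP[h1 h2] := zfactor_uncut r1 gr H isT.
by rewrite !size_rows_zfactor // (column_count_uncut h1) (column_count_uncut h2).
Qed.

(** Desubstitution: uncut, the two columns meet the same blocks, and the odd one lists the columns,
    the even one the rows, of the letters replaced. Both columns fit into the factor, so the length
    at least halves. *)
Lemma unblock_zfactor r g t L : 1 < r -> g.*2.+1 < r -> uncut g (zfactor r t L) ->
  exists t' L', unblock g (zfactor r t L) = zfactor r t' L' /\ L'.*2 <= L.
Proof.
move=> r1 gr H; have gr' : g.*2 < r by lia.
case: (posnP L) H => [-> _|L0 H]; first by exists 0, 0.
have /andP[h1 h2] := zfactor_uncut r1 gr H L0.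
exists (column_count r g.*2 t), (column_count r g.*2 (t + L) - column_count r g.*2 t); split.
  rewrite /unblock !rows_zfactor // -(column_count_uncut h1) -(column_count_uncut h2).
  by rewrite zip_map; apply: eq_map => s; rewrite /= odd_double.
have : size (rows g.*2.+1 (zfactor r t L)) + size (rows g.*2 (zfactor r t L)) <= L.
  rewrite /rows !size_map !size_filter.
  have : size (zfactor r t L) = L by rewrite size_map size_iota.
  move: (zfactor r t L) => s <-.
  elim: s => //= c s IH; do 2 case: eqP => ? /=; lia.
by rewrite (size_rows_uncut r1 gr H) size_rows_zfactor // addnn.
Qed.

Lemma column_sorted_zfactor r t L : 1 < r ->
  sorted (fun c c' => (c.1.+1 %% r) == c'.1) (zfactor r t L).
Proof.
move=> r1; case: L => //= L; elim: L t => //= L IH t.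
by rewrite IH andbT -addn1 modnDml addn1.
Qed.

Lemma sorted_map_filter (C : Type) (R : rel C) (f : nat -> C) (a : pred nat) t L :
  (forall i i', a i -> a i' -> i < i' -> (forall k, i < k < i' -> ~~ a k) -> R (f i) (f i')) ->
  sorted R [seq f i | i <- iota t L & a i].
Proof.
move=> H; elim: L t => //= L IH t; case: ifP => // at_.
have {IH}: forall n t', t < t' -> (forall k, t < k < t' -> ~~ a k) ->
    path R (f t) [seq f i | i <- iota t' n & a i]; last first.
  by move/(_ L t.+1); apply => // k; lia.
move=> n; elim: n t at_ {IH} => //= n IH t at_ t' tt' no.
case: ifP => at'; last first.
  apply: IH => //; first by lia.
  by move=> k hk; case: (eqVneq k t') => [->|?]; [rewrite at'|apply: no; lia].
by rewrite /= H //= IH // => k; lia.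
Qed.

(* Consecutive letters in columns lo < hi of the same parity: a lo-letter is followed by the hi-letter
   of its own block, so both have the same row; nothing relates a hi-letter to the next lo-letter. *)
Definition row_out (lo : nat) (c : nat * nat) : option nat := if c.1 == lo then Some c.2 else None.
Definition row_in (lo : nat) (c : nat * nat) : option nat := if c.1 == lo then None else Some c.2.

(** Since [None] equals only [None], the condition encodes alternation of the columns as well as
    equality of rows. Its form [E c == S c'] is the one that [rees_equiv_sorted] transfers. *)
Lemma row_sorted_zfactor r lo hi t L : 1 < r -> lo < hi < r -> odd lo = odd hi ->
  sorted (fun c c' => row_out lo c == row_in lo c')
    [seq c <- zfactor r t L | (c.1 == lo) || (c.1 == hi)].
Proof.
move=> r1 /andP[lohi hir] par; rewrite filter_map; apply: sorted_map_filter => i i' /=.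
rewrite /row_out /row_in /=.
have := divn_eq i r; have := divn_eq i' r.
have : i %% r < r by rewrite ltn_pmod; lia.
have : i' %% r < r by rewrite ltn_pmod; lia.
move: (i %/ r) (i %% r) (i' %/ r) (i' %% r) => a b a' b' b'r br Ei' Ei hb hb' ii' no.
have no1 c d : d < r -> (d == lo) || (d == hi) -> ~ (i < c * r + d < i').
  by move=> dr hd /no /=; rewrite modnMDl modn_small // hd.
case/orP: hb => /eqP eb; last first.
  have -> : (b == lo) = false by lia.
  case/orP: hb' => /eqP eb'; first by rewrite eb' eqxx.
  (* Two letters of column [hi] are never consecutive: column [lo] of the next block lies between
     them. *)
  have no_lo := no1 a.+1 lo (ltn_trans lohi hir); rewrite eqxx in no_lo.
  have aa' : a < a'.
    by rewrite ltnNge; apply/negP => le; have : a' * r <= a * r; [rewrite leq_mul2r le orbT|lia].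
  have le : a.+1 * r <= a' * r by rewrite leq_mul2r aa' orbT.
  by rewrite mulSn in le no_lo; case: no_lo => //; lia.
rewrite eb eqxx; have no_hi := no1 a hi hir; rewrite eqxx orbT in no_hi.
have ea : a' = a.
  have [lt|lt|//] := ltngtP a' a.
    have : a'.+1 * r <= a * r by rewrite leq_mul2r lt orbT.
    by rewrite mulSn; lia.
  have le : a.+1 * r <= a' * r by rewrite leq_mul2r lt orbT.
  by rewrite mulSn in le; case: no_hi => //; lia.
have eb' : b' = hi by case/orP: hb' => /eqP // eb'; nia.
have -> : (b' == lo) = false by lia.
have := @zword_block r a b r1 br; have := @zword_block r a b' r1 b'r.
rewrite -ea -Ei' ea -Ei /zword => -[_ ->] [_ ->].
by rewrite eb eb' par.
Qed.

(** * The Rees monoid *)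

(* (a, None) is the power c^a of the circle and (a, Some (i, j)) is c^a times the element with top pattern i
   and bottom pattern j; the parameters (al, ta) are (0, true) inside K_3 and (1, false) inside K_4. *)
Definition rees_car : Type := (nat * option (bool * bool))%type.

Definition rees_shape (s s' : option (bool * bool)) : option (bool * bool) :=
  match s, s' with
  | Some p, Some q => Some (p.1, q.2)
  | None, _ => s'
  | _, None => s
  end.

(** The exponent of the sandwich entry: gluing equal patterns closes one circle more than gluing
    different ones. *)
Definition rees_circles (al : nat) (s s' : option (bool * bool)) : nat :=
  match s, s' with
  | Some p, Some q => al + (p.2 == q.1)
  | _, _ => 0
  end.

Definition rees_mul (al : nat) (x y : rees_car) : rees_car :=
  (x.1 + y.1 + rees_circles al x.2 y.2, rees_shape x.2 y.2).

(** The rotation exchanges top and bottom and also left and right; the latter swaps the two patterns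
    of K_3 and fixes those of K_4. *)
Definition rees_star_shape (ta : bool) (s : option (bool * bool)) : option (bool * bool) :=
  omap (fun p => (p.2 (+) ta, p.1 (+) ta)) s.

Definition rees_star (ta : bool) (x : rees_car) : rees_car := (x.1, rees_star_shape ta x.2).

Definition rees (al : nat) (ta : bool) : istruct := @IStruct rees_car (rees_mul al) (rees_star ta).

Lemma rees_mulA al : associative (rees_mul al).
Proof.
by move=> [a [[i j]|]] [b [[k l]|]] [c [[p q]|]]; rewrite /rees_mul /=; congr (_, _); lia.
Qed.

Lemma rees_starK ta : involutive (rees_star ta).
Proof. by move=> [a [[i j]|]]; rewrite /rees_star //= !addbK. Qed.

Lemma rees_starM al ta x y :
  rees_star ta (rees_mul al x y) = rees_mul al (rees_star ta y) (rees_star ta x).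
Proof.
case: x y => [a [[i j]|]] [b [[k l]|]]; rewrite /rees_mul /rees_star /=; congr (_, _); lia.
Qed.

Lemma rees_invsg al ta : is_invsg (rees al ta).
Proof.
split; first by move=> x y z; rewrite /= rees_mulA.
by split; [exact: rees_starK|exact: rees_starM].
Qed.

Definition rees_prod (al : nat) (I : Type) (m : I -> rees_car) (u : seq I) : rees_car :=
  foldr (fun k => rees_mul al (m k)) (0, None) u.

Lemma rees_mul1 al x : rees_mul al x (0, None) = x.
Proof. by case: x => a [p|]; rewrite /rees_mul /= ?addn0. Qed.

Lemma rees_1mul al x : rees_mul al (0, None) x = x.
Proof. by case: x => a [p|]; rewrite /rees_mul /= ?addn0. Qed.

Lemma rees_prod_cat al I (m : I -> rees_car) u v :
  rees_prod al m (u ++ v) = rees_mul al (rees_prod al m u) (rees_prod al m v).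
Proof. by elim: u => [|k u IH] /=; rewrite ?rees_1mul // IH rees_mulA. Qed.

Lemma rees_prod_map al I J (f : I -> J) (m : J -> rees_car) u :
  rees_prod al m (map f u) = rees_prod al (m \o f) u.
Proof. by elim: u => //= k u ->. Qed.

Lemma eq_in_rees_prod al (I : eqType) (m m' : I -> rees_car) u :
  {in u, m =1 m'} -> rees_prod al m u = rees_prod al m' u.
Proof.
elim: u => //= k u IH e; rewrite e ?mem_head // IH // => j ju.
by rewrite e // inE ju orbT.
Qed.

Lemma rees_prod_filter al I (D : pred I) (m : I -> rees_car) u :
  (forall k, ~~ D k -> m k = (0, None)) ->
  rees_prod al m u = rees_prod al m (filter D u).
Proof.
move=> mD; elim: u => //= k u IH; case: ifP => [_|/negbT /mD ->] /=; first by rewrite IH.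
by rewrite rees_1mul IH.
Qed.

Fixpoint adjacencies (I : Type) (P : rel I) (x : I) (u : seq I) : nat :=
  if u is y :: u' then P x y + adjacencies P y u' else 0.

Lemma adjacencies0 I (P : rel I) x u :
  (adjacencies P x u == 0) = path (fun i j => ~~ P i j) x u.
Proof. by elim: u x => //= y u IH x; rewrite addn_eq0 IH; case: (P x y). Qed.

Lemma adjacencies_le I (P : rel I) x u : adjacencies P x u <= size u.
Proof. by elim: u x => //= y u IH x; rewrite -add1n leq_add ?leq_b1. Qed.

Lemma adjacencies_size I (P : rel I) x u : (adjacencies P x u == size u) = path P x u.
Proof.
elim: u x => //= y u IH x; have := adjacencies_le P y u; rewrite -IH.
by case: (P x y) => /=; rewrite ?add1n ?add0n ?eqSS // => le; rewrite ltn_eqF.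
Qed.

(** Circles arise only at junctions of consecutive letters: [al] at each, and one more where the
    patterns agree. *)
Lemma rees_prod_Some al (I : eqType) (l r : I -> bool) x u :
  rees_prod al (fun k => (0, Some (l k, r k))) (x :: u) =
  (al * size u + adjacencies (fun i j => r i == l j) x u, Some (l x, r (last x u))).
Proof.
elim: u x => [|y u IH] x; first by rewrite /= rees_mul1 muln0.
rewrite [LHS]/= -[rees_mul al (0, Some (l y, _)) _]/(rees_prod al (fun k => (0, Some (l k, r k))) (y :: u)).
by rewrite IH /rees_mul /=; congr (_, _); lia.
Qed.

Lemma rees_prod_count al (I : eqType) k (u : seq I) :
  rees_prod al (fun i => ((i == k) : nat, None)) u = (count_mem k u, None).
Proof. by elim: u => //= i u ->; rewrite /rees_mul /= addn0. Qed.

(** * Words with equal values in the Rees monoid *)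

Definition rees_equiv (al : nat) (u v : seq nat) : Prop :=
  forall m : nat -> rees_car, rees_prod al m u = rees_prod al m v.

(** Sending [k] to one circle and the other letters to the identity counts the occurrences of
    [k]. *)
Lemma rees_equiv_perm al u v : rees_equiv al u v -> perm_eq u v.
Proof.
move=> uv; apply/allP => k _ /=.
by have := uv (fun i => ((i == k) : nat, None)); rewrite !rees_prod_count => -[->].
Qed.

(** Evaluating the letters outside [D] at the identity deletes them. *)
Lemma rees_equiv_filter al (D : pred nat) u v :
  rees_equiv al u v -> rees_equiv al (filter D u) (filter D v).
Proof.
move=> uv m; have := uv (fun k => if D k then m k else (0, None)).
rewrite (@rees_prod_filter al _ D _ u) ?(@rees_prod_filter al _ D _ v); try by move=> k /negbTE ->.
by rewrite (@eq_in_rees_prod al _ _ m) ?(@eq_in_rees_prod al _ _ m (filter D v)) // => k;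
  rewrite mem_filter => /andP[->].
Qed.

(** A product keeps the top pattern of its first letter, and only [x] is given the top pattern
    [true]. *)
Lemma rees_equiv_first al x u v : rees_equiv al (x :: u) v -> exists v1, v = x :: v1.
Proof.
move=> uv; have := uv (fun k => (0, Some (k == x, k == x))); rewrite rees_prod_Some eqxx.
case: v {uv} => // y v; rewrite rees_prod_Some => -[_ /esym /eqP -> _].
by exists v.
Qed.

Lemma rees_equiv_last al x u y v : rees_equiv al (x :: u) (y :: v) -> last x u = last y v.
Proof.
move/(_ (fun k => (0, Some (true, k == last x u)))); rewrite !rees_prod_Some eqxx.
by case=> _ /esym/eqP.
Qed.

(* If the labels agree along u, giving Rees elements the corresponding one-bit labels makes all sandwich
   entries of the product trivial, and the same number of circles forces this along v. *)
Lemma rees_equiv_path al (D : eqType) (E S : nat -> D) x u v :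
  rees_equiv al (x :: u) (x :: v) ->
  path (fun i j => E i == S j) x u -> path (fun i j => E i == S j) x v.
Proof.
move=> uv pu; have szv : size u = size v by have /perm_size := rees_equiv_perm uv => -[].
have key d : path (fun i j => (E i == d) == (S j == d)) x v.
  have := uv (fun k => (0, Some (S k != d, E k == d))); rewrite !rees_prod_Some => -[+ _].
  rewrite szv => /addnI e.
  have /eqP adj0 : adjacencies (fun i j => (E i == d) == (S j != d)) x u == 0.
    rewrite adjacencies0; apply: sub_path pu => i j /eqP ->.
    by case: (_ == d).
  move/eqP: e; rewrite adj0 eq_sym adjacencies0; apply: sub_path => i j.
  by case: (E i == d); case: (S j == d).
elim: v x key {u uv pu szv} => //= y v IH x key.
(* The bit test at the value [d = E x] recovers the full equality of labels. *)
have /= /andP[/eqP e _] := key (E x); rewrite eqxx in e; rewrite eq_sym -e /=.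
by apply: IH => d; have /= /andP[] := key d.
Qed.

Lemma flatten_map_filter (I C : eqType) (psi : I -> seq C) u :
  flatten (map psi (filter (fun k => psi k != [::]) u)) = flatten (map psi u).
Proof. by elim: u => //= k u <-; case: eqP => [->|]. Qed.

Lemma path_flatten (I C : eqType) (R : rel C) (psi : I -> seq C) c0 x u :
  {in x :: u, forall k, psi k != [::]} ->
  sorted R (flatten (map psi (x :: u))) =
  all (fun k => sorted R (psi k)) (x :: u) &&
  path (fun i j => R (last c0 (psi i)) (head c0 (psi j))) x u.
Proof.
elim: u x => [|y u IH] x ne /=; first by rewrite cats0 !andbT.
have := ne x; rewrite mem_head => /(_ isT).
have := ne y; rewrite !inE eqxx orbT => /(_ isT).
have {IH ne} := IH y (fun k ku => ne k ltac:(by rewrite inE ku orbT)); rewrite /=.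
case: (psi x) (psi y) => // c s [] // d t /= ih _ _.
by rewrite cat_path /= ih -!andbA; do !bool_congr.
Qed.

(** After deletion of the letters with empty image, sortedness splits into a condition on each
    image, which permutations preserve, and a condition at the junctions, which [rees_equiv_path]
    transfers with the labels of the last and first entries of the images. *)
Lemma rees_equiv_sorted al (C D : eqType) (psi : nat -> seq C) (E S : C -> D) u v :
  rees_equiv al u v ->
  sorted (fun c c' => E c == S c') (flatten (map psi u)) ->
  sorted (fun c c' => E c == S c') (flatten (map psi v)).
Proof.
move=> uv; rewrite -[flatten (map psi u)]flatten_map_filter -[flatten (map psi v)]flatten_map_filter.
have := rees_equiv_filter (fun k => psi k != [::]) uv.
have : all (fun k => psi k != [::]) (filter (fun k => psi k != [::]) u) by apply: filter_all.
move: (filter _ u) (filter _ v) => {uv}u {}v neu uv.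
have pe := rees_equiv_perm uv; have nev := neu; rewrite (perm_all _ pe) in nev.
case: u uv neu pe => [|x u] uv neu pe; first by have := perm_size pe; case: v {uv pe nev}.
have [v1 def_v] := rees_equiv_first uv; move: uv nev pe; rewrite {v}def_v => uv /allP nev pe.
have c0 : C by move: neu => /= /andP[]; case: (psi x).
rewrite !(path_flatten _ c0) //; last by apply/allP.
case/andP=> alls; rewrite -(perm_all _ pe) alls.
exact: (rees_equiv_path (E := fun k => E (last c0 (psi k))) (S := fun k => S (head c0 (psi k)))).
Qed.

Lemma rees_equiv_ohead al (C : eqType) (psi : nat -> seq C) u v :
  rees_equiv al u v -> ohead (flatten (map psi u)) = ohead (flatten (map psi v)).
Proof.
move=> uv; rewrite -[flatten (map psi u)]flatten_map_filter -[flatten (map psi v)]flatten_map_filter.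
have := rees_equiv_filter (fun k => psi k != [::]) uv.
have : all (fun k => psi k != [::]) (filter (fun k => psi k != [::]) u) by apply: filter_all.
move: (filter _ u) (filter _ v) => {uv}u {}v neu uv.
case: u uv neu => [|x u] uv neu.
  by have /perm_size := rees_equiv_perm uv; case: v {uv}.
have [v1 ->] := rees_equiv_first uv.
by move: neu => /= /andP[]; case: (psi x).
Qed.

Lemma rees_equiv_olast al (C : eqType) (psi : nat -> seq C) u v :
  rees_equiv al u v -> ohead (rev (flatten (map psi u))) = ohead (rev (flatten (map psi v))).
Proof.
move=> uv; rewrite -[flatten (map psi u)]flatten_map_filter -[flatten (map psi v)]flatten_map_filter.
have := rees_equiv_filter (fun k => psi k != [::]) uv.
have : all (fun k => psi k != [::]) (filter (fun k => psi k != [::]) u) by apply: filter_all.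
move: (filter _ u) (filter _ v) => {uv}u {}v neu uv.
case: u uv neu => [|x u] uv neu.
  by have /perm_size := rees_equiv_perm uv; case: v {uv}.
have [v1 def_v] := rees_equiv_first uv; subst v.
have := rees_equiv_last uv => e.
have: psi (last x u) != [::] by exact: (allP neu _ (mem_last x u)).
rewrite (lastI x u) (lastI x v1) -e !map_rcons !flatten_rcons !rev_cat.
by case/lastP: (psi (last x u)) => // s c _; rewrite rev_rcons.
Qed.

Lemma rees_equiv_size al (C : eqType) (psi : nat -> seq C) u v :
  rees_equiv al u v -> size (flatten (map psi u)) = size (flatten (map psi v)).
Proof.
move=> uv; apply: perm_size; apply: perm_flatten; apply: perm_map; exact: rees_equiv_perm uv.
Qed.

(** * Reconstruction of factors from their columns *)

Lemma cat_zfactor r t L s1 s2 : s1 ++ s2 = zfactor r t L ->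
  s1 = zfactor r t (size s1) /\ s2 = zfactor r (t + size s1) (size s2).
Proof.
move=> e; have szL : L = size s1 + size s2 by rewrite -size_cat e size_map size_iota.
move/eqP: e; rewrite szL zfactorD eqseq_cat ?size_map ?size_iota //.
by case/andP=> /eqP <- /eqP <-.
Qed.

Lemma zfactor_flatten r t L (psi : nat -> seq (nat * nat)) u k :
  flatten (map psi u) = zfactor r t L -> k \in u ->
  exists t', psi k = zfactor r t' (size (psi k)).
Proof.
move=> e /path.splitPr ku; move: e; case: ku => u1 u2.
rewrite map_cat flatten_cat /= => /cat_zfactor[_ /cat_zfactor[e _]].
by eexists; exact: e.
Qed.

Lemma ohead_flatten (psi : nat -> seq (nat * nat)) u c :
  ohead (flatten (map psi u)) = Some c -> exists2 k, k \in u & ohead (psi k) = Some c.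
Proof.
elim: u => //= k u IH; case E: (psi k) => [|d s] /=.
  by move/IH => [j ju e]; exists j; rewrite // inE ju orbT.
by move=> [<-]; exists k; rewrite ?mem_head // E.
Qed.

Lemma olast_flatten (psi : nat -> seq (nat * nat)) u c :
  ohead (rev (flatten (map psi u))) = Some c -> exists2 k, k \in u & ohead (rev (psi k)) = Some c.
Proof.
elim: u => //= k u IH; rewrite rev_cat; case E: (rev (flatten _)) IH => [|d s] /= IH.
  by move=> e; exists k; rewrite ?mem_head.
by move/IH => [j ju e]; exists j; rewrite // inE ju orbT.
Qed.

Lemma uncut_flatten g (psi : nat -> seq (nat * nat)) u :
  {in u, forall k, uncut g (psi k)} -> uncut g (flatten (map psi u)).
Proof.
move=> H c; split; first by case/ohead_flatten => k /H /(_ c)[h _] /h.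
by case/olast_flatten => k /H /(_ c)[_ h] /h.
Qed.

(** Pigeonhole: each image spoils at most two values of [g], through its first and its last letter,
    so one of [n.*2.+1] values survives. *)
Lemma exists_uncut n (psi : nat -> seq (nat * nat)) u : size u <= n ->
  exists2 g, g <= n.*2 & {in u, forall k, uncut g (psi k)}.
Proof.
move=> szu.
pose bad k := [seq c.1./2 | c <- pmap id [:: ohead (psi k); ohead (rev (psi k))]].
have size_bad : size (flatten (map bad u)) <= n.*2.
  apply: leq_trans (_ : (size u).*2 <= _); last by rewrite leq_double.
  elim: u {szu} => //= k u IH; rewrite size_cat doubleS -addn2 addnC leq_add //.
  by rewrite size_map size_pmap /=; case: (ohead _) => [c|]; case: (ohead _).
have [/allP sub|] := boolP (all (mem (flatten (map bad u))) (iota 0 n.*2.+1)).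
  by have := uniq_leq_size (iota_uniq _ _) sub; rewrite size_iota leqNgt ltnS size_bad.
case/allPn => g; rewrite mem_iota /= ?add0n ltnS => gn /negP gbad; exists g => // k ku c.
have badE d : d \in bad k -> d != g.
  move=> dk; apply/eqP => e; apply: gbad; apply/flattenP; exists (bad k); first exact: map_f.
  by rewrite -e.
have nb : g \notin bad k by apply/negP => /badE; rewrite eqxx.
split=> e; apply: contra nb => /eqP ec; rewrite /bad /= e.
  by case: (ohead _) => [d|] /=; rewrite inE ec /= uphalf_double eqxx.
by case: (ohead (psi k)) => [d|] /=; rewrite !inE ec doubleK eqxx ?orbT.
Qed.

Lemma rows_cat j s1 s2 : rows j (s1 ++ s2) = rows j s1 ++ rows j s2.
Proof. by rewrite /rows filter_cat map_cat. Qed.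

Lemma unblock_flatten g (psi : nat -> seq (nat * nat)) u :
  {in u, forall k, size (rows g.*2.+1 (psi k)) = size (rows g.*2 (psi k))} ->
  flatten (map (unblock g \o psi) u) = unblock g (flatten (map psi u)) /\
  size (rows g.*2.+1 (flatten (map psi u))) = size (rows g.*2 (flatten (map psi u))).
Proof.
elim: u => //= k u IH H.
have [|-> e] := IH; first by move=> j ju; apply: H; rewrite inE ju orbT.
have ek := H k (mem_head _ _).
by rewrite /unblock !rows_cat zip_cat // !size_cat ek e.
Qed.

(** The column sequence tells from which list of rows the next letter is taken. *)
Lemma eq_rows s s' : map fst s = map fst s' ->
  {in map fst s, forall j, rows j s = rows j s'} -> s = s'.
Proof.
elim: s s' => [|[a b] s IH] [|[a' b'] s'] //= [<- e] H.
have := H a (mem_head _ _); rewrite /rows /= eqxx /= => -[<- _]; congr (_ :: _).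
apply: IH => // j js; have := H j; rewrite inE js orbT => /(_ isT).
by rewrite /rows /=; case: eqP => //= _ [].
Qed.

Lemma sorted_determined (T U : eqType) (f : T -> U) (R : rel T) s s' :
  (forall c d c' d', f c = f d -> R c c' -> R d d' -> f c' = f d') ->
  sorted R s -> sorted R s' -> size s = size s' -> ohead s = ohead s' -> map f s = map f s'.
Proof.
move=> HR; case: s s' => [|c s] [|d s'] //= ps ps' [sz] [ecd]; congr (_ :: _); first by rewrite ecd.
have {ecd} : f c = f d by rewrite ecd.
elim: s s' c d sz ps ps' => [|c' s IH] [|d' s'] //= c d [sz] /andP[r1 p1] /andP[r2 p2] e.
by have e' := HR _ _ _ _ e r1 r2; rewrite e' (IH s' c' d').
Qed.

(** A letter outside column [k] copies the row of the [k]-letter before it; only the first letter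
    has no predecessor, whence the hypothesis on [ohead]. *)
Lemma rows_determined k o (R : rel (nat * nat)) s s' :
  (forall c c', R c c' -> (c.1 == k) || (c.1 == o) -> (c'.1 == k) || (c'.1 == o) ->
     if c.1 == k then (c'.1 != k) && (c'.2 == c.2) else c'.1 == k) ->
  all (fun c => (c.1 == k) || (c.1 == o)) s -> all (fun c => (c.1 == k) || (c.1 == o)) s' ->
  sorted R s -> sorted R s' -> size s = size s' -> ohead s = ohead s' ->
  rows k s = rows k s' -> s = s'.
Proof.
move=> HR; case: s s' => [|c s] [|d s'] //= /andP[kc ks] /andP[_ ks'] ps ps' [sz] [ecd] er.
subst d; congr (_ :: _).
have {}er : rows k s = rows k s' by move: er; rewrite /rows /=; case: ifP => //= _ [].
elim: s s' c kc ks ks' sz ps ps' er => [|x s IH] [|x' s'] //= c kc.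
move=> /andP[kx ks] /andP[kx' ks'] [sz] /andP[r1 p1] /andP[r2 p2].
have := HR _ _ r1 kc kx; have := HR _ _ r2 kc kx'; case: (c.1 == k).
  case/andP=> nk' /eqP e' /andP[nk /eqP e]; rewrite /rows /= (negbTE nk) (negbTE nk') => er.
  have exx' : x = x'.
    move: kx kx'; rewrite (negbTE nk) (negbTE nk') /= => /eqP h /eqP h'.
    by rewrite (surjective_pairing x) (surjective_pairing x') h h' e e'.
  by subst x'; congr (_ :: _); apply: (IH s' x).
move=> h' h; rewrite /rows /= h h' /= => -[e er].
have exx' : x = x'.
  by rewrite (surjective_pairing x) (surjective_pairing x') (eqP h) (eqP h') e.
by subst x'; congr (_ :: _); apply: (IH s' x).
Qed.

Lemma rows_filter j (a : pred (nat * nat)) s :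
  (forall c, c.1 == j -> a c) -> rows j (filter a s) = rows j s.
Proof.
move=> ja; rewrite /rows -filter_predI; congr map; apply: eq_filter => c /=.
by case: eqP => //= /eqP /ja ->.
Qed.

(** The alternation of the two columns passes from [u] to [v]. Read forwards, the rows of [lo] then
    determine those of [hi]; read backwards, those of [hi] determine those of [lo]. *)
Lemma rees_equiv_rows al r t L (psi : nat -> seq (nat * nat)) u v lo hi :
  1 < r -> lo < hi < r -> odd lo = odd hi -> rees_equiv al u v ->
  flatten (map psi u) = zfactor r t L ->
  (rows lo (flatten (map psi u)) = rows lo (flatten (map psi v))) <->
  (rows hi (flatten (map psi u)) = rows hi (flatten (map psi v))).
Proof.
move=> r1 lohi par uv def_u; have /andP[lh hr] := lohi.
pose a (c : nat * nat) := (c.1 == lo) || (c.1 == hi).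
pose chi := filter a \o psi.
have filterE w : flatten (map chi w) = filter a (flatten (map psi w)).
  by rewrite filter_flatten -map_comp.
have rowsE j w : (j == lo) || (j == hi) -> rows j (flatten (map psi w)) = rows j (flatten (map chi w)).
  by move=> jj; rewrite filterE rows_filter // => c /eqP; rewrite /a => ->.
have su : sorted (fun c c' => row_out lo c == row_in lo c') (flatten (map chi u)).
  by rewrite filterE def_u; apply: row_sorted_zfactor.
have sv := rees_equiv_sorted uv su.
have ehead := rees_equiv_ohead chi uv; have elast := rees_equiv_olast chi uv.
have esize := rees_equiv_size chi uv.
have alla w : all a (flatten (map chi w)) by rewrite filterE filter_all.
have alla' w : all (fun c => (c.1 == hi) || (c.1 == lo)) (flatten (map chi w)).
  by rewrite (eq_all (a2 := a)) // => c; rewrite orbC.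
rewrite !rowsE ?eqxx ?orbT //; split => er; last first.
  suff -> : flatten (map chi u) = flatten (map chi v) by [].
  rewrite -[LHS]revK -[RHS]revK; congr rev.
  apply: (@rows_determined hi lo (fun c c' => row_out lo c' == row_in lo c)).
  - move=> [i p] [i' p']; rewrite /row_in /row_out /= => /eqP e /orP[] /eqP ei /orP[] /eqP ei';
      move: e; rewrite ei ei' ?eqxx ?(gtn_eqF lh) ?(ltn_eqF lh) //= => -[->]; by rewrite eqxx.
  - by rewrite all_rev.
  - by rewrite all_rev.
  - by rewrite rev_sorted.
  - by rewrite rev_sorted.
  - by rewrite !size_rev.
  - by [].
  - by rewrite /rows !filter_rev !map_rev -!/(rows _ _) er.
suff -> : flatten (map chi u) = flatten (map chi v) by [].
apply: (@rows_determined lo hi (fun c c' => row_out lo c == row_in lo c')) => //.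
move=> [i p] [i' p']; rewrite /row_in /row_out /= => /eqP e /orP[] /eqP ei /orP[] /eqP ei';
  move: e; rewrite ei ei' ?eqxx ?(gtn_eqF lh) ?(ltn_eqF lh) //= => -[->]; by rewrite eqxx.
Qed.

(** Strong induction on the length of the factor: the desubstituted word gives the rows of an uncut
    pair of columns, and parity spreads them to all columns. *)
Lemma rees_equiv_zfactor al n t L (psi : nat -> seq (nat * nat)) u v :
  rees_equiv al u v -> size u <= n ->
  flatten (map psi u) = zfactor n.*2.+1.*2 t L ->
  flatten (map psi v) = flatten (map psi u).
Proof.
move=> + szu; elim/ltn_ind: L t psi u v szu => L IH t psi u v szu uv def_u.
case: (posnP n) => [n0|n_gt0].
  have u0 : u = [::] by case: (u) szu; rewrite ?n0.
  by have := perm_size (rees_equiv_perm uv); rewrite u0; case: (v).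
set r := n.*2.+1.*2 in def_u *; have r1 : 1 < r by rewrite /r; lia.
have esize := rees_equiv_size psi uv.
have szL : size (flatten (map psi u)) = L by rewrite def_u size_map size_iota.
case: (posnP L) => [L0|L_gt0].
  by apply: etrans (_ : [::] = _); apply/eqP; rewrite -?[[::] == _]eq_sym -?size_eq0 -?esize szL L0.
have [g gn cut] := exists_uncut psi szu.
have gr : g.*2.+1 < r by rewrite /r; lia.
have sub_u k : k \in u -> exists t', psi k = zfactor r t' (size (psi k)).
  exact: zfactor_flatten def_u.
have mem_vu k : k \in v -> k \in u by rewrite (perm_mem (rees_equiv_perm uv)).
have szk : {in u, forall k, size (rows g.*2.+1 (psi k)) = size (rows g.*2 (psi k))}.
  move=> k ku; have [t' e] := sub_u k ku; rewrite e; apply: size_rows_uncut => //.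
  by rewrite -e; apply: cut.
have [eu szru] := unblock_flatten szk.
have [ev szrv] := unblock_flatten (fun k kv => szk k (mem_vu k kv)).
have [t' [L' [eL' szL']]] : exists t' L', unblock g (flatten (map psi u)) = zfactor r t' L' /\ L'.*2 <= L.
  by rewrite def_u; apply: unblock_zfactor => //; rewrite -def_u; apply: uncut_flatten.
(* The words [u] and [v] stay the same, so the bound [n] persists; only the images shrink. *)
have eW : unblock g (flatten (map psi v)) = unblock g (flatten (map psi u)).
  rewrite -ev -eu; apply: (IH L' _ t' (unblock g \o psi)) => //; first by lia.
  by rewrite eu.
have row1 : rows g.*2.+1 (flatten (map psi u)) = rows g.*2.+1 (flatten (map psi v)).
  by have /(congr1 unzip1) := eW; rewrite /unblock !unzip1_zip ?szru ?szrv.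
have row0 : rows g.*2 (flatten (map psi u)) = rows g.*2 (flatten (map psi v)).
  by have /(congr1 unzip2) := eW; rewrite /unblock !unzip2_zip ?szru ?szrv.
(* The first letter fixes the first column, and each column is the cyclic successor of the one
   before. *)
have cols : map fst (flatten (map psi u)) = map fst (flatten (map psi v)).
  apply: (@sorted_determined _ _ fst (fun c c' => c.1.+1 %% r == c'.1)) => //.
  - by move=> c d c' d' e /eqP <- /eqP <-; rewrite e.
  - by rewrite def_u column_sorted_zfactor.
  - apply: (@rees_equiv_sorted _ _ _ psi (fun c => c.1.+1 %% r) fst _ _ uv).
    by rewrite def_u column_sorted_zfactor.
  - exact: rees_equiv_ohead uv.
apply/esym/(eq_rows cols) => j.
rewrite def_u -map_comp => /mapP[i _ ->] /=; set c := i %% r.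
have cr : c < r by rewrite ltn_pmod; lia.
rewrite -def_u.
(* The uncut pair contains one column of each parity. *)
have [h [hpar hr erow]] : exists h, [/\ odd h = odd c, h < r &
    rows h (flatten (map psi u)) = rows h (flatten (map psi v))].
  by case oddc : (odd c); [exists g.*2.+1|exists g.*2]; rewrite /= ?odd_double; split => //; lia.
case: (ltngtP h c) => [hc|ch|<- //].
  have H := @rees_equiv_rows al r t L psi u v h c r1 _ hpar uv def_u.
  by apply/H => //; rewrite hc cr.
have H := @rees_equiv_rows al r t L psi u v c h r1 _ (esym hpar) uv def_u.
by apply/H => //; rewrite ch hr.
Qed.

(** * Terms as words in starred letters *)

Definition flip (p : nat * bool) : nat * bool := (p.1, ~~ p.2).

Fixpoint flat (t : term) : seq (nat * bool) :=
  match t with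
  | tvar k => [:: (k, false)]
  | tmul t1 t2 => flat t1 ++ flat t2
  | tstar t1 => rev (map flip (flat t1))
  end.

Definition rees_letter (ta : bool) (v : nat -> rees_car) (p : nat * bool) : rees_car :=
  if p.2 then rees_star ta (v p.1) else v p.1.

Lemma eval_rees al ta (v : nat -> rees_car) t :
  @eval (rees al ta) v t = rees_prod al (rees_letter ta v) (flat t).
Proof.
elim: t => [k|t1 IH1 t2 IH2|t IH] /=; first by rewrite rees_mul1.
  by rewrite IH1 IH2 rees_prod_cat.
rewrite IH; elim: (flat t) => // p U IHU.
rewrite [LHS]/= rees_starM IHU /= rev_cons -cats1 rees_prod_cat /= rees_mul1; congr rees_mul.
by rewrite /rees_letter /=; case: p.2; rewrite ?rees_starK.
Qed.

(* The starred and the unstarred copy of a letter carrying the Rees element (0, ~~ ta) are told apart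
   by the first coordinate and by the circles between consecutive letters. *)
Lemma rees_polarity al ta (U V : seq (nat * bool)) (pol : nat -> bool) :
  (forall v, rees_prod al (rees_letter ta v) U = rees_prod al (rees_letter ta v) V) ->
  {in U, forall p, p.2 = pol p.1} ->
  {in V, forall p, p.2 = pol p.1} /\ rees_equiv al (unzip1 U) (unzip1 V).
Proof.
move=> UV polU.
have perm1 : perm_eq (unzip1 U) (unzip1 V).
  apply/allP => k _ /=; have := UV (fun i => ((i == k) : nat, None)).
  rewrite !(@eq_in_rees_prod al _ (rees_letter ta (fun i => ((i == k) : nat, None)))
    ((fun i => ((i == k) : nat, None)) \o fst)); try by move=> p _; rewrite /rees_letter; case: p.2.
  by rewrite -!rees_prod_map !rees_prod_count => -[->].
have polV : {in V, forall p, p.2 = pol p.1}.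
  move=> [k b] kbV /=.
  pose x : rees_car := (0, Some (false, ~~ ta)).
  (* [de] marks the occurrences of [k] with the wrong polarity; [m] gives their values. *)
  pose de (q : nat * bool) := q.2 != pol q.1.
  pose m (q : nat * bool) : rees_car := (0, Some (de q, de q (+) ~~ ta)).
  have := UV (fun i => if i == k then (if pol k then rees_star ta x else x) else (0, None)).
  set val := fun i => _.
  have valE q : q.1 == k -> rees_letter ta val q = m q.
    case: q => i c /= /eqP ->; rewrite /rees_letter /m /de /val /x /= eqxx.
    by case: c; case: (pol k); case: (ta).
  have filterE W : rees_prod al (rees_letter ta val) W
      = rees_prod al m (filter (fun q => q.1 == k) W).
    rewrite (@rees_prod_filter al _ (fun q => q.1 == k)); last first.
      by move=> [i c] /= /negbTE ik; rewrite /rees_letter /val /= ik; case: c.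
    by apply: eq_in_rees_prod => q; rewrite mem_filter => /andP[/valE ->].
  rewrite !filterE.
  have szW W : size (filter (fun q : nat * bool => q.1 == k) W) = count_mem k (unzip1 W).
    by rewrite size_filter count_map.
  have : size (filter (fun q => q.1 == k) U) = size (filter (fun q => q.1 == k) V).
    by rewrite !szW (seq.permP perm1).
  have : (k, b) \in filter (fun q => q.1 == k) V by rewrite mem_filter /= eqxx.
  have : {in filter (fun q => q.1 == k) U, forall q, ~~ de q}.
    by move=> q; rewrite mem_filter => /andP[_ qU]; rewrite /de polU ?eqxx.
  move: (filter _ U) (filter _ V) => U1 V1.
  case: V1 => // q V1 deU; case: U1 deU => // p U1 deU kbV1 [sz].
  rewrite !rees_prod_Some sz => -[/addnI adj ehead _].
  have adjV : path (fun i j => de i == de j) q V1.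
    have allU (P : rel (nat * bool)) : (forall i j, ~~ de i -> ~~ de j -> P i j) -> path P p U1.
      move=> HP; elim: (U1) (p) deU => //= y s IHs z H; rewrite HP ?IHs ?H ?mem_head //.
        by move=> i si; apply: H; rewrite inE si orbT.
      by rewrite inE mem_head orbT.
    (* Letters of constant polarity agree at every junction if [ta] is true and at none if it is
       false; so the count for [U] is extremal, and the equal count forces constant polarity along
       [V]. *)
    case ta_eq : ta adj => /= adj.
      have : path (fun i j => de i (+) false == de j) q V1.
        rewrite -adjacencies_size -adj -sz adjacencies_size; apply: allU => i j.
        by case: (de i); case: (de j).
      by apply: sub_path => i j; rewrite addbF.
    have : path (fun i j => ~~ (de i (+) true == de j)) q V1.
      rewrite -adjacencies0 -adj adjacencies0; apply: allU => i j.
      by case: (de i); case: (de j).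
    by apply: sub_path => i j; case: (de i); case: (de j).
  have deq : ~~ de q by rewrite -ehead; apply: deU; rewrite mem_head.
  have : all (fun i => ~~ de i) (q :: V1).
    elim: V1 q deq adjV {kbV1 sz adj ehead} => [|y s IHs] q deq /=; first by rewrite deq.
    by rewrite deq => /andP[/eqP e ps] /=; apply: IHs => //; rewrite -e.
  by move/allP/(_ _ kbV1); rewrite /de negbK => /eqP.
split=> // m0.
(* Starring the values of the letters that occur starred cancels their stars. *)
pose val k := if pol k then rees_star ta (m0 k) else m0 k.
have letterE p : p.2 = pol p.1 -> rees_letter ta val p = m0 p.1.
  by rewrite /rees_letter /val => ->; case: (pol p.1); rewrite ?rees_starK.
rewrite !rees_prod_map -(@eq_in_rees_prod al _ (rees_letter ta val) _ U) ?UV; last first.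
  by move=> p /polU; apply: letterE.
by apply: eq_in_rees_prod => p /polV; apply: letterE.
Qed.

(** * The involution semigroup of factors *)

(* Some (false, s) is the factor s, Some (true, s) its formal star, and None is zero. *)
Definition zcar : Type := option (bool * seq (nat * nat)).

(** The prefix of length [N] makes being a factor a decidable condition. *)
Definition zguard (r N : nat) (x : zcar) : zcar :=
  if x is Some p then if infix p.2 (zfactor r 0 N) then x else None else None.

(** Starred words are stored unreversed, hence joined in the opposite order; mixed polarities give
    zero. *)
Definition zjoin (x y : zcar) : zcar :=
  match x, y with
  | Some (b, s), Some (b', s') =>
      if b == b' then Some (b, if b then s' ++ s else s ++ s') else None
  | _, _ => None
  end.

Definition zmul (r N : nat) (x y : zcar) : zcar := zguard r N (zjoin x y).

Definition zstar (x : zcar) : zcar := omap (fun p => (~~ p.1, p.2)) x.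

Definition zsg (r N : nat) : istruct := @IStruct zcar (zmul r N) zstar.

Lemma zjoinA : associative zjoin.
Proof.
by move=> [[[] s]|] [[[] s']|] [[[] s'']|] //=; rewrite catA.
Qed.

Lemma infix_factor (T : eqType) (s1 s2 s w : seq T) : infix (s1 ++ s ++ s2) w -> infix s w.
Proof.
case/infixP => [p [q ->]]; apply/infixP; exists (p ++ s1), (s2 ++ q).
by rewrite !catA.
Qed.

(** A word that contains a non-factor is not a factor. *)
Lemma zguard_joinl r N x y : zguard r N (zjoin (zguard r N x) y) = zguard r N (zjoin x y).
Proof.
case: x y => [[b s]|] [[b' s']|] //=; case fs : (infix s _) => //=.
case: (b == b') => //=; case: ifP => // fi; move: fs => /negP[]; move: fi; case: b => fi.
  by apply: (@infix_factor _ s' [::]); rewrite cats0; exact: fi.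
exact: (@infix_factor _ [::] s').
Qed.

Lemma zguard_joinr r N x y : zguard r N (zjoin x (zguard r N y)) = zguard r N (zjoin x y).
Proof.
case: x y => [[b s]|] [[b' s']|] //=; case fs : (infix s' _) => //=.
case: (b == b') => //=; case: ifP => // fi; move: fs => /negP[]; move: fi; case: b => fi.
  exact: (@infix_factor _ [::] s).
by apply: (@infix_factor _ s [::]); rewrite cats0; exact: fi.
Qed.

Lemma zstarK : involutive zstar.
Proof. by move=> [[b s]|] //=; rewrite negbK. Qed.

Lemma zstar_join x y : zstar (zjoin x y) = zjoin (zstar y) (zstar x).
Proof. by case: x y => [[[] s]|] [[[] s']|]. Qed.

Lemma zstar_guard r N x : zstar (zguard r N x) = zguard r N (zstar x).
Proof. by case: x => [[b s]|] //=; case: ifP. Qed.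

Lemma zsg_invsg r N : is_invsg (zsg r N).
Proof.
split=> [x y z|]; first by rewrite /= /zmul zguard_joinl zguard_joinr zjoinA.
split; first exact: zstarK.
by move=> x y; rewrite /= /zmul zstar_guard zstar_join.
Qed.

Definition zletter (v : nat -> zcar) (p : nat * bool) : zcar :=
  if p.2 then zstar (v p.1) else v p.1.

Fixpoint zprod (v : nat -> zcar) (U : seq (nat * bool)) : zcar :=
  match U with
  | [::] => None
  | p :: U' => if U' is [::] then zletter v p else zjoin (zletter v p) (zprod v U')
  end.

Lemma zprod_cat v U V : U != [::] -> V != [::] ->
  zprod v (U ++ V) = zjoin (zprod v U) (zprod v V).
Proof.
move=> + V0; elim: U => // p [|q U] IH _; first by case: V V0 {IH}.
rewrite cat_cons [zprod v (p :: _)]/= -[zprod v (p :: q :: U)]/(zjoin _ (zprod v (q :: U))).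
by rewrite -zjoinA -IH.
Qed.

Lemma flat_neq0 t : flat t != [::].
Proof.
by elim: t => //= [t1 IH1 t2 _|t]; [case: (flat t1) IH1|rewrite -!size_eq0 size_rev size_map].
Qed.

Lemma zprod_star v U : zprod v (rev (map flip U)) = zstar (zprod v U).
Proof.
have letE p : zletter v (flip p) = zstar (zletter v p).
  by rewrite /zletter /=; case: p.2; rewrite ?zstarK.
elim: U => // p [|q U] IH; first by rewrite /= letE.
rewrite map_cons rev_cons -cats1 zprod_cat //; last by rewrite -size_eq0 size_rev.
by rewrite IH -[zprod v (p :: _)]/(zjoin (zletter v p) (zprod v (q :: U))) zstar_join /= letE.
Qed.

(** Only products are guarded, so a single letter keeps its value even if that is not a factor;
    guards inside a product may be postponed to the end. *)
Lemma eval_zsg r N v t :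
  @eval (zsg r N) v t =
  if size (flat t) == 1 then zprod v (flat t) else zguard r N (zprod v (flat t)).
Proof.
elim: t => [k|t1 IH1 t2 IH2|t IH] //=.
  have [n1 n2] := (flat_neq0 t1, flat_neq0 t2).
  rewrite size_cat; have -> : (size (flat t1) + size (flat t2) == 1) = false.
    by case: (flat t1) n1 => // p U _; case: (flat t2) n2 => // q V _; rewrite /= addnS.
  rewrite zprod_cat // IH1 IH2 /zmul.
  by do 2 case: ifP => _; rewrite ?zguard_joinl ?zguard_joinr.
by rewrite IH size_rev size_map zprod_star; case: ifP => //; rewrite zstar_guard.
Qed.

Definition zfst (v : nat -> zcar) (k : nat) : bool := if v k is Some p then p.1 else false.
Definition zsnd (v : nat -> zcar) (k : nat) : seq (nat * nat) := if v k is Some p then p.2 else [::].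

Lemma zprod_unstarred v U s : U != [::] ->
  zprod v U = Some (false, s) <->
  {in U, forall p, v p.1 /\ p.2 = zfst v p.1} /\ s = flatten (map (zsnd v) (unzip1 U)).
Proof.
have letE p s0 : zletter v p = Some (false, s0) <->
    (v p.1 /\ p.2 = zfst v p.1) /\ s0 = zsnd v p.1.
  rewrite /zletter /zfst /zsnd; case: p => k [] /=; case: (v k) => [[[] s1]|] //=;
    split => //; by [case=> -> | case=> _ -> | case=> [] [] | case=> [] []].
elim: U s => // p [|q U] IH s _.
  rewrite [zprod _ _]/= letE /= cats0; split=> [[h ->]|[h ->]].
    by split=> // p'; rewrite inE => /eqP ->.
  by split=> //; apply: h; rewrite mem_head.
rewrite -[zprod v (p :: _)]/(zjoin (zletter v p) (zprod v (q :: U))); split.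
  case E1 : (zletter v p) => [[b s1]|] //; case E2 : (zprod v (q :: U)) => [[b' s2]|] //=.
  case: eqP => // eb [b0]; subst b b'; move=> <-.
  move/letE: E1 => [h1 ->]; move/IH: E2 => [//|h2 e2]; split; last by rewrite e2.
  by move=> p'; rewrite inE => /predU1P[->|/h2].
case=> h ->.
have /letE -> : (v p.1 /\ p.2 = zfst v p.1) /\ zsnd v p.1 = zsnd v p.1.
  by split=> //; apply: h; rewrite mem_head.
have /IH -> // : {in q :: U, forall p, v p.1 /\ p.2 = zfst v p.1} /\
    flatten (map (zsnd v) (unzip1 (q :: U))) = flatten (map (zsnd v) (unzip1 (q :: U))).
by split=> // p' p'U; apply: h; rewrite inE p'U orbT.
Qed.

Lemma infix_zfactor r N s : infix s (zfactor r 0 N) -> exists t, s = zfactor r t (size s).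
Proof.
by case/infixP => p [q /esym /cat_zfactor[_ /cat_zfactor[e _]]]; eexists; exact: e.
Qed.

(** A nonzero unstarred value fixes the polarity of every letter, so [rees_polarity] reduces the
    claim to words without stars and [rees_equiv_zfactor] settles those. *)
Lemma zsg_unstarred al ta n N t1 t2 v s :
  sat (rees al ta) (t1, t2) -> size (flat t1) <= n ->
  @eval (zsg n.*2.+1.*2 N) v t1 = Some (false, s) ->
  @eval (zsg n.*2.+1.*2 N) v t2 = Some (false, s).
Proof.
move=> sat12 sz1; set r := n.*2.+1.*2; rewrite !eval_zsg => ev1.
have [pr1 guard1] : zprod v (flat t1) = Some (false, s) /\
    (size (flat t1) == 1) || infix s (zfactor r 0 N).
  move: ev1; case: ifP => // _; case: (zprod v (flat t1)) => [[b s']|] //=.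
  by case: ifP => // fi [-> <-].
have /zprod_unstarred := pr1; case/(_ (flat_neq0 t1)) => good1 def_s.
have prod12 m : rees_prod al (rees_letter ta m) (flat t1) = rees_prod al (rees_letter ta m) (flat t2).
  by rewrite -!eval_rees; apply: sat12.
have pol1 : {in flat t1, forall p, p.2 = zfst v p.1} by move=> p /good1[].
have [pol2 eqv] := rees_polarity prod12 pol1.
have pe := rees_equiv_perm eqv.
have szE : size (flat t2) = size (flat t1) by rewrite -!(size_map fst) (perm_size pe).
have good2 : {in flat t2, forall p, v p.1 /\ p.2 = zfst v p.1}.
  move=> p p2; split; last exact: pol2.
  have : p.1 \in unzip1 (flat t1) by rewrite (perm_mem pe) map_f.
  by case/mapP => p' /good1[? _] ->.
have s2 : flatten (map (zsnd v) (unzip1 (flat t2))) = s.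
  (* The value of a single letter may be a non-factor, but then both words are that letter. *)
  rewrite def_s; case/orP: guard1 => [sz|/infix_zfactor[t fs]].
    move: pe sz szE; case: (flat t1) => [|p []] //; case: (flat t2) => [|q []] //= pe _ _.
    by have := perm_mem pe q.1; rewrite !inE eqxx => /eqP ->.
  have szu : size (unzip1 (flat t1)) <= n by rewrite size_map.
  have fz : flatten (map (zsnd v) (unzip1 (flat t1))) = zfactor r t (size s) by rewrite -def_s.
  exact: rees_equiv_zfactor eqv szu fz.
have /(zprod_unstarred v s (flat_neq0 t2)) -> :
    {in flat t2, forall p, v p.1 /\ p.2 = zfst v p.1} /\ s = flatten (map (zsnd v) (unzip1 (flat t2))).
  by split.
by rewrite szE /=; case: ifP guard1 => //= _ ->.
Qed.

(** Starred values reduce to unstarred ones by starring both terms, and symmetry in the two terms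
    handles zero. *)
Lemma zsg_sat al ta n N t1 t2 :
  sat (rees al ta) (t1, t2) -> size (flat t1) <= n -> size (flat t2) <= n ->
  sat (zsg n.*2.+1.*2 N) (t1, t2).
Proof.
move=> sat12 sz1 sz2 v; set r := n.*2.+1.*2 => /=.
have half t t' : sat (rees al ta) (t, t') -> size (flat t) <= n ->
    forall p, @eval (zsg r N) v t = Some p -> @eval (zsg r N) v t' = Some p.
  move=> sattt szt [[] s] e; last exact: zsg_unstarred sattt szt e.
  have : @eval (zsg r N) v (tstar t') = Some (false, s).
    apply: (@zsg_unstarred al ta n N (tstar t)).
    - by move=> m; rewrite /= (sattt m).
    - by rewrite /= size_rev size_map.
    - by rewrite /= e.
  by rewrite /=; case: (eval v t') => [[[] s']|] //= [->].
have h1 := half _ _ sat12 sz1.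
have h2 := half _ _ (fun m => esym (sat12 m)) sz2.
case e1 : (@eval (zsg r N) v t1) => [p|]; first by rewrite (h1 _ e1).
case e2 : (@eval (zsg r N) v t2) => [p|] //.
by rewrite (h2 _ e2) in e1.
Qed.

(** * An identity of the wire monoid *)

Definition word_term (s : seq nat) : term :=
  if s is x :: s' then foldl (fun t y => tmul t (tvar y)) (tvar x) s' else tvar 0.

Lemma flat_word_term s : s != [::] -> flat (word_term s) = [seq (k, false) | k <- s].
Proof.
case: s => //= x s _; rewrite -[_ :: map _ s]/(flat (tvar x) ++ _).
elim: s (tvar x) => [|y s IH] t /=; first by rewrite cats0.
by rewrite IH /= -catA.
Qed.

Lemma eq_eval (S : istruct) (v v' : nat -> icar S) t :
  {in flat t, forall p, v p.1 = v' p.1} -> eval v t = eval v' t.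
Proof.
elim: t => [k|t1 IH1 t2 IH2|t IH] /= e; first by apply: (e (k, false)); rewrite inE.
  by rewrite IH1 ?IH2 // => p pt; apply: e; rewrite mem_cat pt ?orbT.
rewrite IH // => p pt; have := e (flip p); apply.
by rewrite mem_rev map_f.
Qed.

(** Forgetting the circles leaves the multiplication of the Brauer monoid, which is finite. *)
Definition brauer (n : nat) : istruct := @IStruct (matching n) (@prod_match n) id.

Lemma eval_wire_matching n (v : nat -> wire n) s :
  (@eval (Wrho n) v (word_term s)).1 = @eval (brauer n) (fst \o v) (word_term s).
Proof.
case: s => //= x s.
have : (@eval (Wrho n) v (tvar x)).1 = @eval (brauer n) (fst \o v) (tvar x) by [].
by elim: s (tvar x) => [|y s IH] t // et; apply: IH; rewrite /= et.
Qed.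

Definition swap_identity (s1 s2 s3 : seq nat) : identity :=
  (tmul (tmul (word_term s1) (word_term s2)) (word_term s3),
   tmul (tmul (word_term s3) (word_term s2)) (word_term s1)).

(** The outer factors differ only in their numbers of circles; new cycles depend on the matchings
    alone, and the given circles add up commutatively. *)
Lemma sat_swap_identity n s1 s2 s3 :
  (forall rho : nat -> matching n,
     @eval (brauer n) rho (word_term s1) = @eval (brauer n) rho (word_term s3)) ->
  sat (Wrho n) (swap_identity s1 s2 s3).
Proof.
move=> e13 v; have := e13 (fst \o v); rewrite -!eval_wire_matching /=.
move: (eval v _) (eval v _) (eval v _) => [a1 d1] [a2 d2] [a3 d3] /= ->.
by rewrite /wmul /=; congr (_, _); lia.
Qed.

(** Restricting to [K] variables makes the type of these functions finite, as the pigeonhole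
    requires. *)
Definition matching_image (n K : nat) (s : seq nat) :
    {ffun {ffun 'I_K -> matching n} -> matching n} :=
  [ffun rho => @eval (brauer n)
     (fun k => if insub k is Some i then fun_of_fin rho i else idm n) (word_term s)].

Lemma matching_imageP n K s1 s2 : s1 != [::] -> s2 != [::] ->
  all (fun k => k < K) s1 -> all (fun k => k < K) s2 ->
  matching_image n K s1 = matching_image n K s2 ->
  forall rho : nat -> matching n,
    @eval (brauer n) rho (word_term s1) = @eval (brauer n) rho (word_term s2).
Proof.
move=> n1 n2 /allP K1 /allP K2 e rho.
have evE s : s != [::] -> {in s, forall k, k < K} ->
    @eval (brauer n) rho (word_term s) = matching_image n K s [ffun i : 'I_K => rho i].
  move=> n0 Ks; rewrite ffunE; apply: eq_eval => p.
  rewrite flat_word_term // => /mapP[k ks ->] /=.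
  by rewrite (insubT (fun k => k < K) (Ks k ks)) ffunE.
by rewrite !evE // e.
Qed.

Definition code (r : nat) (c : nat * nat) : nat := c.1 * r + c.2.

Definition zassign (r : nat) (k : nat) : zcar := Some (false, [:: (k %/ r, k %% r)]).

Lemma zprod_code r s : s != [::] -> all (fun c => c.2 < r) s ->
  zprod (zassign r) [seq (k, false) | k <- map (code r) s] = Some (false, s).
Proof.
move=> s0 sr; apply/zprod_unstarred; first by rewrite -size_eq0 !size_map size_eq0.
split; first by move=> p /mapP[k _ ->].
rewrite /unzip1 -!map_comp; elim: s {s0} sr => //= c s IH /andP[cr /IH <-] /=; congr (_ :: _).
by rewrite /code divnMDl ?divn_small ?addn0 ?modnMDl ?modn_small -?surjective_pairing //; lia.
Qed.

(** Equality would place [s2] at the offsets [size s1] and [size s3]; as [s2] is at least as long as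
    the shift, this is a square. *)
Lemma zfactor_not_swap r a L s1 s2 s3 : 3 < r ->
  zfactor r a L = s1 ++ s2 ++ s3 -> size s1 < size s3 -> size s3 - size s1 <= size s2 ->
  s1 ++ s2 ++ s3 <> s3 ++ s2 ++ s1.
Proof.
move=> r3 def_s lt13 le2 e.
have szL : L = size s1 + size s2 + size s3.
  by rewrite -addnA -!size_cat -def_s size_map size_iota.
have nthE i : i < L -> nth (0, 0) (zfactor r a L) i = zword r (a + i).
  by move=> iL; rewrite (nth_map 0) ?size_iota // nth_iota.
apply: (@zword_square_free r (a + size s1) (size s3 - size s1)) => //; first by lia.
move=> d dlt.
have -> : a + size s1 + d + (size s3 - size s1) = a + (size s3 + d) by lia.
rewrite -addnA -!nthE; try lia.
rewrite [in RHS](etrans def_s e) def_s !nth_cat.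
have -> : (size s1 + d < size s1) = false by lia.
have -> : (size s3 + d < size s3) = false by lia.
rewrite !addKn.
by have -> : (d < size s2) by lia.
Qed.

Lemma all_zfactor r t L : 1 < r -> all (fun c => (c.1 < r) && (c.2 < r)) (zfactor r t L).
Proof. by move=> r1; apply/allP => c /mapP[i _ ->]; apply: zword_bound. Qed.

Lemma Wrho_zsg_separated n r : 3 < r ->
  exists e N, sat (Wrho n) e /\ ~ sat (zsg r N) e.
Proof.
move=> r3; have r1 : 1 < r by lia.
pose A : finType := {ffun {ffun 'I_(r * r) -> matching n} -> matching n}.
(* [M.+1] windows of distinct lengths compete for [M] functions; the spacing [D] leaves a gap
   between two windows that exceeds the difference of their lengths. *)
pose M := #|A|; pose D := M.+1.*2.
pose win (i : nat) := zfactor r (i * D) i.+1.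
pose img (i : 'I_M.+1) : A := matching_image n (r * r) (map (code r) (win i)).
have [i [i' [ii' eimg]]] : exists i i' : 'I_M.+1, i < i' /\ img i = img i'.
  have /injectivePn[i [i' ne e]] : ~~ injectiveb img.
    by apply/negP => /injectiveP/leq_card; rewrite card_ord ltnn.
  case: (ltngtP i i') => [lt|lt|/val_inj eq]; first by exists i, i'.
    by exists i', i.
  by rewrite eq eqxx in ne.
have iM := ltn_ord i; have i'M := ltn_ord i'.
pose gap := i' * D - (i * D + i.+1).
have hD : i * D + i.+1 + (i' - i) <= i' * D.
  have : i.+1 * D <= i' * D by rewrite leq_mul2r ii' orbT.
  by rewrite mulSn /D; lia.
pose s2 := zfactor r (i * D + i.+1) gap.
have def_s : zfactor r (i * D) (i.+1 + (gap + i'.+1)) = win i ++ s2 ++ win i'.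
  by rewrite !zfactorD /win /s2; congr (_ ++ (_ ++ zfactor _ _ _)); rewrite /gap; lia.
pose N := i' * D + i'.+1.
have all_s t L : all (fun k => k < r * r) (map (code r) (zfactor r t L)).
  rewrite all_map; apply: sub_all (all_zfactor t L r1) => -[x y] /= /andP[xr yr].
  rewrite /code /=; have : x.+1 * r <= r * r by rewrite leq_mul2r xr orbT.
  by rewrite mulSn; lia.
exists (swap_identity (map (code r) (win i)) (map (code r) s2) (map (code r) (win i'))), N.
split.
  apply: sat_swap_identity.
  exact: (@matching_imageP n (r * r) (map (code r) (win i)) (map (code r) (win i')) isT isT (all_s _ _) (all_s _ _) eimg).
move/(_ (zassign r)) => sat_z.
have gap0 : 0 < gap by rewrite /gap; lia.
have ne2 : s2 != [::] by rewrite -size_eq0 size_map size_iota -lt0n.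
have eval_win x y : x != [::] -> y != [::] ->
    all (fun c => (c.1 < r) && (c.2 < r)) (x ++ s2 ++ y) ->
    @eval (zsg r N) (zassign r) (tmul (tmul (word_term (map (code r) x))
      (word_term (map (code r) s2))) (word_term (map (code r) y))) =
    zguard r N (Some (false, x ++ s2 ++ y)).
  move=> nx ny small; rewrite eval_zsg.
  have -> : flat (tmul (tmul (word_term (map (code r) x)) (word_term (map (code r) s2)))
      (word_term (map (code r) y))) = [seq (k, false) | k <- map (code r) (x ++ s2 ++ y)].
    have ne_map w : w != [::] -> map (code r) w != [::] by case: w.
    by rewrite /= !flat_word_term ?ne_map // !map_cat catA.
  rewrite !size_map zprod_code; last 2 first.
  - by case: (x) nx.
  - by apply: sub_all small => c /andP[].
  rewrite !size_cat.
  by case: (x) nx => // c x' _; case: (y) ny => // c' y' _; rewrite /= addnA addnS.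
have : zguard r N (Some (false, win i ++ s2 ++ win i')) =
       zguard r N (Some (false, win i' ++ s2 ++ win i)).
  rewrite -!eval_win //; first by rewrite !all_cat !all_zfactor.
  by rewrite -def_s all_zfactor.
have fi : infix (win i ++ s2 ++ win i') (zfactor r 0 N).
  have -> : N = i * D + (i.+1 + (gap + i'.+1)) by rewrite /N /gap; lia.
  rewrite zfactorD add0n def_s; apply/infixP; exists (zfactor r 0 (i * D)), [::].
  by rewrite cats0.
rewrite /zguard fi; case: ifP => // _ /(congr1 (fun x => if x is Some p then p.2 else [::])) /= e.
apply: (zfactor_not_swap r3 def_s _ _ e); rewrite /win /s2 !size_map !size_iota; first by lia.
by rewrite /gap; lia.
Qed.

(** * Products of matchings computed on tables *)

Definition pt_code n (x : pt n) : nat :=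
  match x with inl k => k | inr k => n + k end.

Definition gv_code n (a : gv n) : nat :=
  match a with inl k => k | inr (inl k) => n + k | inr (inr k) => n + n + k end.

Definition outer_code n (c : nat) : nat := if c < n then c else n + c.

Lemma pt_code_inj n : injective (@pt_code n).
Proof.
move=> [k|k] [l|l] /= e; have := ltn_ord k; have := ltn_ord l; try lia.
  by move=> _ _; congr inl; apply: val_inj.
by move=> _ _; congr inr; apply: val_inj; rewrite /=; lia.
Qed.

Lemma pt_code_lt n (x : pt n) : pt_code x < n + n.
Proof. by case: x => k /=; have := ltn_ord k; lia. Qed.

Lemma pt_codeP n c : c < n + n -> exists x : pt n, pt_code x = c.
Proof.
move=> cn; case: (ltnP c n) => [lt|ge]; first by exists (inl (Ordinal lt)).
have lt : c - n < n by lia.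
by exists (inr (Ordinal lt)) => /=; lia.
Qed.

Lemma gv_code_inj n : injective (@gv_code n).
Proof.
move=> [k|[k|k]] [l|[l|l]] /= e; have := ltn_ord k; have := ltn_ord l; try lia; move=> _ _.
- by congr inl; apply: val_inj.
- by congr (inr (inl _)); apply: val_inj; rewrite /=; lia.
- by congr (inr (inr _)); apply: val_inj; rewrite /=; lia.
Qed.

Lemma gv_code_lt n (a : gv n) : gv_code a < n + n + n.
Proof. by case: a => [k|[k|k]] /=; have := ltn_ord k; lia. Qed.

Lemma gv_codeP n c : c < n + n + n -> exists a : gv n, gv_code a = c.
Proof.
move=> cn; case: (ltnP c n) => [lt|ge]; first by exists (inl (Ordinal lt)).
case: (ltnP c (n + n)) => [lt|ge'].
  have lt' : c - n < n by lia.
  by exists (inr (inl (Ordinal lt'))) => /=; lia.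
have lt : c - (n + n) < n by lia.
by exists (inr (inr (Ordinal lt))) => /=; lia.
Qed.

Lemma sigma_code n (x : pt n) : gv_code (sigma_v x) = pt_code x.
Proof. by case: x. Qed.

Lemma tau_code n (x : pt n) : gv_code (tau_v x) = n + pt_code x.
Proof. by case: x => k //=; rewrite addnA. Qed.

Lemma omega_code n (x : pt n) : gv_code (omega_v x) = outer_code n (pt_code x).
Proof. by rewrite /outer_code; case: x => k /=; have hk := ltn_ord k; case: ltnP => ?; lia. Qed.

(** Matchings become lists of numbers, on which concrete products can be evaluated. *)
Definition has_table n (f : matching n) (F : seq nat) : Prop :=
  forall x, pt_code (val f x) = nth 0 F (pt_code x).

Lemma has_table_inj n (f g : matching n) F : has_table f F -> has_table g F -> f = g.
Proof.
by move=> fF gF; apply/val_inj/ffunP => x; apply: pt_code_inj; rewrite fF gF.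
Qed.

Lemma mk_matching_table n (d f : matching n) (r : pt n -> pt n -> bool) F :
  has_table f F -> (forall x y, r x y = (pt_code y == nth 0 F (pt_code x))) ->
  mk_matching d r = f.
Proof.
move=> fF rF; apply: val_inj; rewrite /mk_matching.
have -> : [ffun x => odflt x [pick y | r x y]] = val f.
  apply/ffunP => x; rewrite ffunE; case: pickP => [y|/(_ (val f x))] /=.
    by rewrite rF -fF => /eqP /pt_code_inj.
  by rewrite rF -fF eqxx.
by rewrite valKd.
Qed.

Definition table_ok n (F : seq nat) : bool :=
  all (fun c => [&& nth 0 F c < n + n, nth 0 F (nth 0 F c) == c & nth 0 F c != c])
    (iota 0 (n + n)).

Definition table_matching n (F : seq nat) : matching n :=
  mk_matching (idm n) (fun x y => pt_code y == nth 0 F (pt_code x)).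

Lemma table_matchingP n F : table_ok n F -> has_table (table_matching n F) F.
Proof.
move=> /allP okF.
have ok (x : pt n) : [&& nth 0 F (pt_code x) < n + n,
    nth 0 F (nth 0 F (pt_code x)) == pt_code x & nth 0 F (pt_code x) != pt_code x].
  by apply: okF; rewrite mem_iota pt_code_lt.
pose f : {ffun pt n -> pt n} := [ffun x => odflt x [pick y | pt_code y == nth 0 F (pt_code x)]].
have fE x : pt_code (f x) = nth 0 F (pt_code x).
  rewrite ffunE; case: pickP => [y /eqP //|no].
  have /and3P[/pt_codeP[y ey] _ _] := ok x.
  by have := no y; rewrite ey eqxx.
have fm : is_matching f.
  apply/forallP => x; have /and3P[_ e ne] := ok x; apply/andP; split.
    by apply/eqP/pt_code_inj; rewrite !fE; apply/eqP.
  by apply: contra ne => /eqP e'; rewrite -fE e'.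
by move=> x; rewrite /table_matching /mk_matching val_insubd fm fE.
Qed.

Definition neighbors n (F1 F2 : seq nat) (c : nat) : seq nat :=
  (if c < n + n then [:: nth 0 F1 c] else [::]) ++
  (if n <= c then [:: n + nth 0 F2 (c - n)] else [::]).

Definition reach n (F1 F2 : seq nat) (c : nat) : seq nat :=
  iter (n + n + n) (fun s => undup (s ++ flatten (map (neighbors n F1 F2) s))) [:: c].

(** Tested in each instance, in place of a proof that [n + n + n] rounds of search always
    suffice. *)
Definition reach_closed n (F1 F2 : seq nat) : bool :=
  all (fun c => all (fun d => all (fun e => e \in reach n F1 F2 c) (neighbors n F1 F2 d))
    (reach n F1 F2 c)) (iota 0 (n + n + n)).

Definition check_product n (F1 F2 F3 : seq nat) : bool :=
  all (fun x => all (fun y =>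
    ((y != x) && (outer_code n y \in reach n F1 F2 (outer_code n x))) == (y == nth 0 F3 x))
    (iota 0 (n + n))) (iota 0 (n + n)).

(** Each cycle is counted at its vertex of least code. *)
Definition count_cycles n (F1 F2 : seq nat) : nat :=
  count (fun c => all (fun x => c \notin reach n F1 F2 (outer_code n x)) (iota 0 (n + n)) &&
    all (fun d => c <= d) (reach n F1 F2 c)) (iota 0 (n + n + n)).

Lemma gedge_sym n (f1 f2 : matching n) : symmetric (gedge f1 f2).
Proof.
suff sub a b : gedge f1 f2 a b -> gedge f1 f2 b a by move=> a b; apply/idP/idP; apply: sub.
have invol (f : matching n) x : val f (val f x) = x.
  by have /forallP/(_ x)/andP[/eqP] := valP f.
case/orP=> /existsP[x /andP[/eqP <- /eqP <-]]; apply/orP; [left|right]; apply/existsP.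
  by exists (val f1 x); rewrite invol !eqxx.
by exists (val f2 x); rewrite invol !eqxx.
Qed.

Lemma gedge_neighbors n (f1 f2 : matching n) F1 F2 a b :
  has_table f1 F1 -> has_table f2 F2 ->
  gedge f1 f2 a b = (gv_code b \in neighbors n F1 F2 (gv_code a)).
Proof.
move=> t1 t2; rewrite /neighbors mem_cat; apply/idP/idP.
  case/orP=> /existsP[x /andP[/eqP <- /eqP <-]].
    by rewrite !sigma_code pt_code_lt inE t1 eqxx.
  by rewrite !tau_code leq_addr addKn !inE t2 eqxx orbT.
case/orP.
  case: ifP => // /pt_codeP[x ex]; rewrite inE => /eqP eb; apply/orP; left.
  apply/existsP; exists x; rewrite -!(inj_eq (@gv_code_inj n)) !sigma_code ex eqxx.
  by rewrite eb t1 ex eqxx.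
case: ifP => // le; rewrite inE => /eqP eb; apply/orP; right.
have /pt_codeP[x ex] : gv_code a - n < n + n by have := gv_code_lt a; lia.
apply/existsP; exists x; rewrite -!(inj_eq (@gv_code_inj n)) !tau_code ex.
by rewrite eb t2 ex eqxx andbT; apply/eqP; lia.
Qed.

Lemma neighbors_gv n (f1 f2 : matching n) F1 F2 (a : gv n) c :
  has_table f1 F1 -> has_table f2 F2 ->
  c \in neighbors n F1 F2 (gv_code a) -> exists2 b, gv_code b = c & gedge f1 f2 a b.
Proof.
move=> t1 t2 cN; have [b eb] : exists b : gv n, gv_code b = c.
  move: cN; rewrite /neighbors mem_cat => /orP[]; case: ifP => //.
    by move=> /pt_codeP[x <-]; rewrite inE -t1 => /eqP ->; exists (sigma_v (val f1 x)); rewrite sigma_code.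
  move=> le; have /pt_codeP[x <-] : gv_code a - n < n + n by have := gv_code_lt a; lia.
  by rewrite inE -t2 => /eqP ->; exists (tau_v (val f2 x)); rewrite tau_code.
by exists b; rewrite ?(gedge_neighbors _ _ t1 t2) ?eb.
Qed.

Lemma reach_gv n (f1 f2 : matching n) F1 F2 (a : gv n) c :
  has_table f1 F1 -> has_table f2 F2 ->
  c \in reach n F1 F2 (gv_code a) -> exists2 d, gv_code d = c & connect (gedge f1 f2) a d.
Proof.
move=> t1 t2; rewrite /reach; elim: (n + n + n) c => [|k IH] c.
  by rewrite inE => /eqP ->; exists a.
rewrite iterS mem_undup mem_cat => /orP[/IH //|/flattenP[s /mapP[d /IH[d' <- ad'] ->]]].
move/(neighbors_gv t1 t2) => [b' eb' db']; exists b' => //.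
exact: connect_trans ad' (connect1 db').
Qed.

Lemma connect_reach n (f1 f2 : matching n) F1 F2 a b :
  has_table f1 F1 -> has_table f2 F2 -> reach_closed n F1 F2 ->
  connect (gedge f1 f2) a b = (gv_code b \in reach n F1 F2 (gv_code a)).
Proof.
move=> t1 t2 /allP cl.
have reachN d c : c \in reach n F1 F2 (gv_code a) -> d \in neighbors n F1 F2 c ->
    d \in reach n F1 F2 (gv_code a).
  have /cl/allP clA : gv_code a \in iota 0 (n + n + n) by rewrite mem_iota gv_code_lt.
  by move=> /clA/allP; apply.
apply/idP/idP.
  have: gv_code a \in reach n F1 F2 (gv_code a).
    rewrite /reach; elim: (n + n + n) => [|k IH]; first by rewrite inE.
    by rewrite iterS mem_undup mem_cat IH.
  have path_reach p c : gv_code c \in reach n F1 F2 (gv_code a) -> path (gedge f1 f2) c p ->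
      gv_code (last c p) \in reach n F1 F2 (gv_code a).
    elim: p c => //= d p IH c rc /andP[e]; apply: IH.
    by apply: reachN rc _; rewrite -(gedge_neighbors _ _ t1 t2).
  by move=> ra /connectP[p pp ->]; apply: path_reach.
by case/(reach_gv t1 t2) => d /gv_code_inj ->.
Qed.

Lemma prod_match_table n (f1 f2 f3 : matching n) F1 F2 F3 :
  has_table f1 F1 -> has_table f2 F2 -> has_table f3 F3 ->
  reach_closed n F1 F2 -> check_product n F1 F2 F3 -> prod_match f1 f2 = f3.
Proof.
move=> t1 t2 t3 cl /allP ck; apply: mk_matching_table t3 _ => x y.
rewrite (connect_reach _ _ t1 t2 cl) !omega_code -(inj_eq (@pt_code_inj n)).
have /ck/allP ckx : pt_code x \in iota 0 (n + n) by rewrite mem_iota pt_code_lt.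
have /ckx/eqP : pt_code y \in iota 0 (n + n) by rewrite mem_iota pt_code_lt.
by [].
Qed.

Lemma perm_gv_codes n : perm_eq (map (@gv_code n) (enum {: gv n})) (iota 0 (n + n + n)).
Proof.
apply: uniq_perm; rewrite ?iota_uniq //; first by rewrite (map_inj_uniq (@gv_code_inj n)) enum_uniq.
move=> c; rewrite mem_iota /= add0n; apply/mapP/idP => [[a _ ->]|/gv_codeP[a <-]].
  exact: gv_code_lt.
by exists a; rewrite ?mem_enum.
Qed.

Lemma ncycles_table n (f1 f2 : matching n) F1 F2 :
  has_table f1 F1 -> has_table f2 F2 -> reach_closed n F1 F2 ->
  ncycles f1 f2 = count_cycles n F1 F2.
Proof.
move=> t1 t2 cl; set e := gedge f1 f2.
have csym : connect_sym e by apply/sym_connect_sym/gedge_sym.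
pose comp a := [set b | connect e a b].
pose lead a := (a \in cyc_vert f1 f2) && [forall b, connect e a b ==> (gv_code a <= gv_code b)].
have -> : ncycles f1 f2 = #|[set comp a | a in [set a | lead a]]|.
  rewrite /ncycles -/e; congr #|pred_of_set _|; apply/setP => C; apply/imsetP/imsetP => -[a].
    move=> aC ->.
    pose b := [arg min_(b < a | connect e a b) gv_code b].
    have [ab minb] : connect e a b /\ forall d, connect e a d -> gv_code b <= gv_code d.
      by rewrite /b; case: arg_minnP => [|d]; rewrite ?connect0.
    exists b; last first.
      by apply/setP => d; rewrite !inE; apply: (same_connect csym).
    rewrite inE /lead; apply/andP; split.
      move: aC; rewrite !inE => /forallP H; apply/forallP => x; apply: contra (H x).
      by move/connect_trans; apply; rewrite csym.
    by apply/forallP => d; apply/implyP => bd; apply: minb; exact: connect_trans bd.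
  by rewrite inE => /andP[aC _] ->; exists a.
rewrite card_in_imset => [|a b]; last first.
  rewrite !inE => /andP[_ /forallP la] /andP[_ /forallP lb] eC.
  have ab : connect e a b by have /setP/(_ b) := eC; rewrite !inE connect0.
  apply: gv_code_inj; apply/eqP; rewrite eqn_leq.
  by have /implyP -> := la b; rewrite //; have /implyP -> := lb a; rewrite // csym.
rewrite cardsE cardE /enum_mem size_filter /count_cycles.
rewrite -(seq.permP (perm_gv_codes n)) count_map enumT; apply: eq_count => a /=.
rewrite unfold_in /lead inE; congr (_ && _).
  apply/forallP/allP => [H c|H x].
    rewrite mem_iota /= add0n => /pt_codeP[x <-]; have := H x.
    by rewrite (connect_reach _ _ t1 t2 cl) omega_code.
  rewrite (connect_reach _ _ t1 t2 cl) omega_code; apply: H.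
  by rewrite mem_iota pt_code_lt.
apply/forallP/allP => [H c ca|H b].
  have [b eb ab] := reach_gv t1 t2 ca.
  by have /implyP := H b; rewrite -eb; apply.
by apply/implyP; rewrite (connect_reach _ _ t1 t2 cl) => /H.
Qed.

(** * The Rees monoid inside the Kauffman monoids *)

Definition check_wmul n (F1 F2 F3 : seq nat) (m : nat) : bool :=
  [&& reach_closed n F1 F2, check_product n F1 F2 F3 & count_cycles n F1 F2 == m].

Lemma wmul_table n (f1 f2 f3 : matching n) F1 F2 F3 m a b :
  has_table f1 F1 -> has_table f2 F2 -> has_table f3 F3 -> check_wmul n F1 F2 F3 m ->
  wmul (f1, a) (f2, b) = (f3, a + b + m).
Proof.
move=> t1 t2 t3 /and3P[cl ck /eqP <-].
by rewrite /wmul /= (prod_match_table t1 t2 t3 cl ck) (ncycles_table t1 t2 cl).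
Qed.

Definition id_table n : seq nat := mkseq (fun c => if c < n then n + c else c - n) (n + n).

Definition refl_table n (F : seq nat) : seq nat :=
  mkseq (fun c => nth 0 (id_table n) (nth 0 F (nth 0 (id_table n) c))) (n + n).

Definition alpha_table n : seq nat :=
  mkseq (fun c => if c < n then n + (n.-1 - c) else n.-1 - (c - n)) (n + n).

Definition hook_table n i : seq nat :=
  mkseq (fun c => let k := if c < n then c else c - n in let o := c - k in
    if k.+1 == i then o + i else if k == i then o + i.-1 else nth 0 (id_table n) c) (n + n).

Lemma swap_table n (x : pt n) : nth 0 (id_table n) (pt_code x) = pt_code (swap_pt x).
Proof.
rewrite nth_mkseq ?pt_code_lt //; case: x => k /=; have hk := ltn_ord k; case: ltnP => ?; lia.
Qed.

Lemma idm_table n : has_table (idm n) (id_table n).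
Proof. by move=> x; rewrite swap_table /= ffunE. Qed.

Lemma alphaE n (f : matching n) : has_table f (alpha_table n) -> alpha n = (f, 0).
Proof.
move=> fF; congr (_, _); apply: mk_matching_table fF _ => x y.
rewrite nth_mkseq ?pt_code_lt //; case: x y => k [] l /=;
  have hk := ltn_ord k; have hl := ltn_ord l; case: ltnP => ? ; apply/idP/idP; lia.
Qed.

Lemma hookE n i (f : matching n) : 0 < i < n -> has_table f (hook_table n i) -> hook n i = (f, 0).
Proof.
move=> hi fF; congr (_, _); apply: mk_matching_table fF _ => x y.
rewrite nth_mkseq ?pt_code_lt // swap_table; case: x y => k [] l /=;
  have hk := ltn_ord k; have hl := ltn_ord l; rewrite ?hk ?ltnNge ?leq_addr /= ?addKn ?subnn;
  case: (eqVneq k.+1 i) => ?; case: (eqVneq (k : nat) i) => ?; apply/idP/idP; lia.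
Qed.

Lemma wreflE n (f g : matching n) F d : has_table f F -> has_table g (refl_table n F) ->
  wrefl (f, d) = (g, d).
Proof.
move=> fF gG; congr (_, _); apply: val_inj.
have -> : [ffun x => swap_pt (val f (swap_pt x))] = val g.
  apply/ffunP => x; rewrite ffunE; apply: pt_code_inj.
  by rewrite gG nth_mkseq ?pt_code_lt // swap_table -fF swap_table.
by rewrite valKd.
Qed.

(** It merely proposes a table, which [check_star] then validates. *)
Definition product_table n (F1 F2 : seq nat) : seq nat :=
  mkseq (fun x => head 0 [seq y <- iota 0 (n + n) |
    (y != x) && (outer_code n y \in reach n F1 F2 (outer_code n x))]) (n + n).

Definition check_star n (F G : seq nat) : bool :=
  let R := refl_table n F in let P := product_table n (alpha_table n) R in
  [&& table_ok n (alpha_table n), table_ok n R, table_ok n P,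
      check_wmul n (alpha_table n) R P 0 & check_wmul n P (alpha_table n) G 0].

Lemma wrot_table n (f g : matching n) F G d :
  has_table f F -> has_table g G -> check_star n F G -> wrot (f, d) = (g, d).
Proof.
move=> fF gG /and5P[okA okR okP ckP ckG].
have tA := table_matchingP okA; have tR := table_matchingP okR; have tP := table_matchingP okP.
rewrite /wrot (wreflE d fF tR) (alphaE tA) (wmul_table _ _ tA tR tP ckP).
by rewrite (wmul_table _ _ tP tA gG ckG) !addn0.
Qed.

Notation shape := (option (bool * bool)).

Definition all_shapes : seq shape :=
  [:: None; Some (false, false); Some (false, true); Some (true, false); Some (true, true)].

Lemma mem_all_shapes s : s \in all_shapes. Proof. by case: s => [[[] []]|]. Qed.

Definition check_embedding n al ta (T : shape -> seq nat) : bool :=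
  [&& T None == id_table n,
      all (fun s => table_ok n (T s)) all_shapes,
      all (fun s => all (fun s' => (map (nth 0 (T s)) (iota 0 (n + n)) ==
          map (nth 0 (T s')) (iota 0 (n + n))) ==> (s == s')) all_shapes) all_shapes,
      all (fun s => all (fun s' => check_wmul n (T s) (T s')
          (T (rees_shape s s')) (rees_circles al s s')) all_shapes) all_shapes &
      all (fun s => check_star n (T s) (T (rees_star_shape ta s))) all_shapes].

(** The Rees monoid embeds by sending [(a, s)] to the matching of [s] with [a] circles, and
    substructures inherit identities. *)
Lemma sat_rees_embedding n al ta (T : shape -> seq nat) e :
  check_embedding n al ta T -> (forall s, inK (table_matching n (T s), 0)) ->
  sat (Krho n) e -> sat (rees al ta) e.
Proof.
case/and5P => /eqP T1 /allP okT /allP injT /allP mulT /allP starT genT satK.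
pose f s := table_matching n (T s).
have tf s : has_table (f s) (T s) by apply/table_matchingP/okT/mem_all_shapes.
pose iota_ (x : rees_car) : wire n := (f x.2, x.1).
have iotaM x y : wmul (iota_ x) (iota_ y) = iota_ (rees_mul al x y).
  apply: (wmul_table _ _ (tf _) (tf _) (tf _)).
  exact: (allP (mulT x.2 (mem_all_shapes _)) y.2 (mem_all_shapes _)).
have iota_star x : wrot (iota_ x) = iota_ (rees_star ta x).
  by apply: (wrot_table _ (tf _) (tf _)); exact: (starT x.2 (mem_all_shapes _)).
have circ : circle n = iota_ (1, None).
  congr (_, _); apply: has_table_inj (@idm_table n) _; rewrite -T1; exact: tf.
have iotaK x : inK (iota_ x).
  case: x => a s; elim: a => [|a IH]; first exact: genT.
  have -> : iota_ (a.+1, s) = wmul (circle n) (iota_ (a, s)) by rewrite circ iotaM /rees_mul /= addn0.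
  exact: Km (Kc n) IH.
have iota_inj : injective iota_.
  move=> [a s] [a' s'] e1; have eT : f s = f s' := congr1 fst e1.
  have -> : a = a' := congr1 snd e1; congr (_, _).
  have /allP/(_ s' (mem_all_shapes _)) := injT s (mem_all_shapes _).
  move=> /implyP h; apply/eqP/h/eqP/eq_in_map => c.
  rewrite mem_iota => /= /pt_codeP[x <-].
  by rewrite -(tf s x) -(tf s' x) eT.
move=> v; pose v' k : kel n := exist _ (iota_ (v k)) (iotaK _).
have evalE t : proj1_sig (@eval (Krho n) v' t) = iota_ (@eval (rees al ta) v t).
  elim: t => [k|t1 IH1 t2 IH2|t IH] //=; first by rewrite IH1 IH2 iotaM.
  (* The rotated element is again in the image, hence in the Kauffman monoid, which excludes the
     fallback. *)
  rewrite /krot; case: excluded_middle_informative => [p|[]] /=; first by rewrite IH iota_star.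
  by rewrite IH iota_star.
by apply: iota_inj; rewrite -!evalE satK.
Qed.

(* The pairs (top pattern, bottom pattern) of K_3: pattern false is the cup {1,2}, pattern true the cup {2,3}. *)
Definition K3_table (s : shape) : seq nat :=
  if s is Some (i, j) then
    let free k := if k then 0 else 2 in
    (if i then [:: 3 + free j; 2; 1] else [:: 1; 0; 3 + free j]) ++
    (if j then [:: free i; 5; 4] else [:: 4; 3; free i])
  else id_table 3.

(* The rank zero part of K_4: pattern false is {1,2},{3,4} and pattern true is {1,4},{2,3}. *)
Definition K4_table (s : shape) : seq nat :=
  if s is Some (i, j) then
    (if i then [:: 3; 2; 1; 0] else [:: 1; 0; 3; 2]) ++
    (if j then [:: 7; 6; 5; 4] else [:: 5; 4; 7; 6])
  else id_table 4.

Lemma inK_hook_table n i : 0 < i < n -> table_ok n (hook_table n i) ->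
  inK (table_matching n (hook_table n i), 0).
Proof. by move=> hi ok; rewrite -(hookE hi (table_matchingP ok)); apply: Kh. Qed.

Lemma inK_product_table n F1 F2 F3 :
  table_ok n F1 -> table_ok n F2 -> table_ok n F3 -> check_wmul n F1 F2 F3 0 ->
  inK (table_matching n F1, 0) -> inK (table_matching n F2, 0) ->
  inK (table_matching n F3, 0).
Proof.
move=> ok1 ok2 ok3 ck K1 K2.
have <- := wmul_table 0 0 (table_matchingP ok1) (table_matchingP ok2) (table_matchingP ok3) ck.
exact: Km.
Qed.

Lemma inK_id_table n : table_ok n (id_table n) -> inK (table_matching n (id_table n), 0).
Proof.
move=> ok; rewrite -(has_table_inj (@idm_table n) (table_matchingP ok)); exact: K1.
Qed.

(** The four shapes are h_1, h_2, h_1 h_2 and h_2 h_1. *)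
Lemma sat_K3_rees e : sat (Krho 3) e -> sat (rees 0 true) e.
Proof.
apply: (@sat_rees_embedding 3 0 true K3_table) => [|s]; first by vm_compute.
have h1 : inK (table_matching 3 (K3_table (Some (false, false))), 0).
  exact: (@inK_hook_table 3 1).
have h2 : inK (table_matching 3 (K3_table (Some (true, true))), 0).
  exact: (@inK_hook_table 3 2).
case: s => [[[] []]|] //; last exact: inK_id_table.
  by apply: inK_product_table h2 h1; vm_compute.
by apply: inK_product_table h1 h2; vm_compute.
Qed.

(** The four shapes are h_1 h_3 and its products with h_2 on the right, the left and both sides. *)
Lemma sat_K4_rees e : sat (Krho 4) e -> sat (rees 1 false) e.
Proof.
apply: (@sat_rees_embedding 4 1 false K4_table) => [|s]; first by vm_compute.
have h1 := @inK_hook_table 4 1 isT isT; have h2 := @inK_hook_table 4 2 isT isT.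
have h3 := @inK_hook_table 4 3 isT isT.
have ff : inK (table_matching 4 (K4_table (Some (false, false))), 0).
  by apply: inK_product_table h1 h3; vm_compute.
have ft : inK (table_matching 4 (K4_table (Some (false, true))), 0).
  by apply: inK_product_table ff h2; vm_compute.
case: s => [[[] []]|] //; last exact: inK_id_table.
  by apply: inK_product_table h2 ft; vm_compute.
by apply: inK_product_table h2 ff; vm_compute.
Qed.

(** * Absence of a finite basis *)

Lemma flat_size_bound (l : list identity) :
  exists2 n, 0 < n & forall e, List.In e l -> size (flat e.1) <= n /\ size (flat e.2) <= n.
Proof.
elim: l => [|e l [n n0 IH]]; first by exists 1.
exists (n + size (flat e.1) + size (flat e.2)); first by lia.
by move=> e' [<-|/IH[h1 h2]]; split; lia.
Qed.

(** A finite basis of [V] would hold in the semigroup of factors for a large alphabet, putting it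
    into [V], although it violates an identity of the wire monoid. *)
Lemma not_finitely_based_between al ta n (V : istruct -> Prop) :
  V (rees al ta) -> subclass V (var (Wrho n)) -> ~ finitely_based V.
Proof.
move=> Vrees VW [l Vl]; have [k k0 size_l] := flat_size_bound l.
(* Positivity of [k] gives at least six columns, enough for square-freeness. *)
have r3 : 3 < k.*2.+1.*2 by lia.
have [e [N [We nze]]] := Wrho_zsg_separated n r3.
have Vz : V (zsg k.*2.+1.*2 N).
  apply/Vl; split; first exact: zsg_invsg.
  move=> [t1 t2] el; have [sz1 sz2] := size_l _ el.
  by apply: (@zsg_sat al ta) => //; have /Vl[_ /(_ _ el)] := Vrees.
by apply: nze; have [_ /(_ _ We)] := VW _ Vz.
Qed.

Theorem theorem3 (m : nat) (hm : 4 <= m) (V : istruct -> Prop) :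
  is_variety V ->
  (subclass (var (Krho 3)) V /\ subclass V (var (Wrho m.+1)))
  \/ (subclass (var (Krho 4)) V /\ subclass V (var (Wrho m))) ->
  ~ finitely_based V.
Proof.
move=> _ [[KV VW]|[KV VW]].
  apply: (@not_finitely_based_between 0 true) VW; apply: KV.
  by split; [exact: rees_invsg|exact: sat_K3_rees].
apply: (@not_finitely_based_between 1 false) VW; apply: KV.
by split; [exact: rees_invsg|exact: sat_K4_rees].
Qed.
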